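(* Let $k\geq 3$ be a fixed integer and let $p=p(n)$ satisfy $p\geq \frac{\log^{4k}n}{n^{k-1}}$. Then there is a function $\varepsilon(n)\to 0$ such that, with probability tending to $1$ as $n\to\infty$, the random $k$-partite hypergraph $H^k_{n\times k,p}$ contains at least $(1-\varepsilon(n))n^{k-1}p$ pairwise edge-disjoint perfect matchings.
   Context: $H^k_{n\times k,p}$ denotes the random $k$-partite $k$-uniform hypergraph with disjoint vertex parts $V_1,\dots,V_k$, each of size $n$, in which each $k$-tuple $e\in V_1\times V_2\times\cdots\times V_k$ (i.e. each $k$-set containing exactly one vertex from each part) is an edge independently with probability $p$. A perfect matching is a set of pairwise vertex-disjoint edges covering all $kn$ vertices. *)

(* Defs.v *)
From mathcomp Require Import all_boot all_order all_algebra.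
From mathcomp Require Import reals.

Set Implicit Arguments.
Unset Strict Implicit.
Unset Printing Implicit Defensive.

Import Order.TTheory GRing.Theory Num.Theory.

Local Open Scope ring_scope.

(* The vertex (i, j) is the j-th vertex of the part V_i. *)
Definition vertex (k n : nat) : finType := ('I_k * 'I_n)%type.

Definition is_kpartite_edge (k n : nat) (e : {set vertex k n}) : bool :=
  [forall i : 'I_k, #|[set v in e | v.1 == i]| == 1%N].

Definition complete_kpartite (k n : nat) : {set {set vertex k n}} :=
  [set e | is_kpartite_edge e].

(* Hypergraphs on the fixed vertex set are identified with their edge sets. *)
Definition perfect_matching (k n : nat) (H M : {set {set vertex k n}}) : bool :=
  [&& M \subset H, trivIset M & cover M == [set: vertex k n]].

Definition disjoint_perfect_matchings (k n : nat) (H : {set {set vertex k n}})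
    (F : {set {set {set vertex k n}}}) : bool :=
  [forall M in F, perfect_matching H M] && trivIset F.

(* Edges are present independently with probability [p]: each [H] inside
   [complete_kpartite k n] has weight p^|H| (1-p)^(n^k-|H|). *)
Definition Pr_kpartite (R : realType) (k n : nat) (p : R)
    (A : pred {set {set vertex k n}}) : R :=
  \sum_(H : {set {set vertex k n}} | (H \subset complete_kpartite k n) && A H)
    \prod_(e in complete_kpartite k n) (if e \in H then p else 1 - p).

(* Main.v *)
Require Import Defs.
From HB Require Import structures.
From mathcomp Require Import all_boot all_order all_algebra.
From mathcomp Require Import reals.
From mathcomp Require Import ring lra zify.

Set Implicit Arguments.
Unset Strict Implicit.
Unset Printing Implicit Defensive.

Import Order.TTheory GRing.Theory Num.Theory.

Local Open Scope ring_scope.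

(** Assume first p <= eps^2 / n and split the probability p of each edge into
    about p / q coins of probability q.  The matchings are built one after
    another.  While b > m vertices are uncovered in every part, pick a uniformly
    random edge e among the b^k uncovered ones and toss one coin of e; on success
    e joins the matching.  By symmetry the uncovered set is uniformly random, so
    a given edge expects at most (1/q) sum_b b^-k (b/n)^k <= 1 / (q n^(k-1)) tosses
    per matching, and (1 - O(eps)) p n^(k-1) matchings exhaust only a fraction
    1 - O(eps) of its coins.  When m = n / log^3 n vertices per part remain, about
    log_2 n coins of every uncovered edge are tossed at once; by the fragment
    argument for spread families (Frankston-Kahn-Narayanan-Park, Park-Pham) these
    contain a perfect matching of the rest with probability 1 - eps^2.  Instead of
    a coupling and a concentration inequality, one potential, exponential in the
    number of coins spent, is shown by induction to bound the probability of
    failure.  An edge may succeed twice and serve two matchings; the expected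
    number of such coincidences is at most n^k p^2 <= eps^2 p n^(k-1).  For larger
    p, colour the edges at random with s colours so that p / s <= eps^2 / n, and
    apply the above to each colour class. *)

(** * Random subsequences and random subsets *)

Section Expose.
Variables (R : realFieldType) (T : finType).
Implicit Types (q : R) (t s : seq T) (G : seq T -> R).

(** The entries of [t] act as independent coins of success probability [q], and the value is the
    expectation of [G] at the subsequence of successes. Sequences rather than sets are used so that
    one element can own several coins. *)
Fixpoint expose q t G : R :=
  if t is x :: t' then
    q * expose q t' (fun s => G (x :: s)) + (1 - q) * expose q t' G
  else G [::].

Lemma eq_expose q t G G' : G =1 G' -> expose q t G = expose q t G'.
Proof.
elim: t G G' => [|x t IH] G G' eqG /=; first exact: eqG.
by congr (_ * _ + _ * _); apply: IH => // s; apply: eqG.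
Qed.

Lemma ler_expose q t G G' : 0 <= q <= 1 -> (forall s, G s <= G' s) ->
  expose q t G <= expose q t G'.
Proof.
move=> /andP[q0 q1]; elim: t G G' => [|x t IH] G G' leG /=; first exact: leG.
by apply: lerD; apply: ler_wpM2l; rewrite ?subr_ge0 //; apply: IH => s; apply: leG.
Qed.

Lemma expose_const q t (a : R) : expose q t (fun=> a) = a.
Proof. by elim: t => //= x t ->; ring. Qed.

Lemma exposeD q t G G' :
  expose q t (fun s => G s + G' s) = expose q t G + expose q t G'.
Proof. by elim: t G G' => //= x t IH G G'; rewrite !IH; ring. Qed.

Lemma exposeZ q t (a : R) G : expose q t (fun s => a * G s) = a * expose q t G.
Proof. by elim: t G => //= x t IH G; rewrite !IH; ring. Qed.

Lemma expose_cat q t1 t2 G :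
  expose q (t1 ++ t2) G =
  expose q t1 (fun s1 => expose q t2 (fun s2 => G (s1 ++ s2))).
Proof. by elim: t1 G => //= x t1 IH G; rewrite !IH. Qed.

Definition perm_inv (U : Type) (G : seq T -> U) :=
  forall s s', perm_eq s s' -> G s = G s'.

Lemma perm_inv_cons G x : perm_inv G -> perm_inv (fun s => G (x :: s)).
Proof. by move=> Gp s s' ss'; apply: Gp; rewrite perm_cons. Qed.

Lemma perm_inv_catl G s0 : perm_inv G -> perm_inv (fun s => G (s0 ++ s)).
Proof. by move=> Gp s s' ss'; apply: Gp; rewrite perm_cat2l. Qed.

(** For a permutation-invariant [G] the order of the tosses is immaterial, so any remaining coin may
    be tossed next. This lets the process below choose its coins adaptively. *)
Lemma expose_rem q t G x : perm_inv G -> x \in t ->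
  expose q t G = expose q (x :: rem x t) G.
Proof.
elim: t G => //= y t IH G Gp; rewrite inE; case: eqVneq => [-> //|nyx /= xt].
rewrite (IH (fun s => G (y :: s))) ?(IH G) //=; last exact: perm_inv_cons.
rewrite (@eq_expose _ _ (fun s => G [:: y, x & s]) (fun s => G [:: x, y & s])).
  by rewrite /=; ring.
by move=> s; apply: Gp; rewrite (perm_catCA [:: y] [:: x]).
Qed.

Lemma expose_perm q t t' G : perm_inv G -> perm_eq t t' ->
  expose q t G = expose q t' G.
Proof.
elim: t t' G => [|x t IH] t' G Gp tt'.
  by move: tt'; rewrite perm_sym => /perm_nilP ->.
have xt' : x \in t' by rewrite -(perm_mem tt') mem_head.
rewrite (expose_rem _ Gp xt') /=.
have tr : perm_eq t (rem x t').
  by rewrite -(perm_cons x) (permPl tt') perm_to_rem.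
by rewrite (IH _ _ Gp tr) (IH _ _ (perm_inv_cons x Gp) tr).
Qed.

Lemma expose_pred1 q t x :
  expose q t (fun s => (count_mem x s)%:R) = q * (count_mem x t)%:R.
Proof.
elim: t => [|y t IH] /=; first by rewrite mulr0.
rewrite (@eq_expose _ _ _ (fun s => (y == x)%:R + (count_mem x s)%:R)).
  by rewrite exposeD expose_const IH natrD; ring.
by move=> s; rewrite natrD.
Qed.

(** Counts pairs of positions with equal entries, that is, pairs of successful coins of the same
    edge. *)
Definition coincidences s : nat := (\sum_x 'C(count_mem x s, 2))%N.

Lemma perm_coincidences : perm_inv coincidences.
Proof. by move=> s s' /permP ss'; apply: eq_bigr => x _; rewrite ss'. Qed.

Lemma coincidences_cons x s :
  coincidences (x :: s) = (count_mem x s + coincidences s)%N.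
Proof.
rewrite /coincidences (bigD1 x) //= [in RHS](bigD1 x) //= eqxx add1n binS bin1.
rewrite addnCA addnA; congr (_ + _)%N; apply: eq_bigr => y nyx.
by rewrite eq_sym (negPf nyx).
Qed.

Lemma expose_coincidences q t :
  expose q t (fun s => (coincidences s)%:R) = q ^+ 2 * (coincidences t)%:R.
Proof.
elim: t => [|y t IH] /=.
  by rewrite /coincidences big1 ?mulr0 // => x _; rewrite bin0n.
rewrite (@eq_expose _ _ _ (fun s =>
  (count_mem y s)%:R + (coincidences s)%:R)); last first.
  by move=> s; rewrite coincidences_cons natrD.
by rewrite exposeD expose_pred1 IH coincidences_cons natrD; ring.
Qed.

(** Every element of [B] owns [L] coins, listed block by block: each block yields one independent
    random subset of [B], as the fragment argument requires. *)
Definition layers L (B : {set T}) : seq T := flatten (nseq L (enum B)).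

Lemma count_layers L (B : {set T}) x :
  count_mem x (layers L B) = (L * (x \in B))%N.
Proof.
elim: L => //= L IH; rewrite /layers /= count_cat -/(layers L B) IH mulSn.
by rewrite count_uniq_mem ?enum_uniq // mem_enum.
Qed.

Lemma coincidences_layers L (B : {set T}) :
  coincidences (layers L B) = (#|B| * 'C(L, 2))%N.
Proof.
rewrite /coincidences -sum_nat_const [in RHS]big_mkcond /=; apply: eq_bigr => x _.
by rewrite count_layers; case: ifP => _; rewrite ?muln1 ?muln0 ?bin0n.
Qed.

Definition setprob q (B : {set T}) (G : {set T} -> R) : R :=
  \sum_(W : {set T} | W \subset B) (\prod_(x in B) (if x \in W then q else 1 - q)) * G W.

Lemma setprob0 q (G : {set T} -> R) : setprob q set0 G = G set0.
Proof.
rewrite /setprob (eq_bigl (pred1 set0)); last by move=> W; rewrite subset0.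
by rewrite big_pred1_eq big_set0 mul1r.
Qed.

Lemma setprobU1 q x (B : {set T}) (G : {set T} -> R) : x \notin B ->
  setprob q (x |: B) G =
  q * setprob q B (fun W => G (x |: W)) + (1 - q) * setprob q B G.
Proof.
move=> xB; rewrite /setprob (bigID (fun W : {set T} => x \in W)) /=.
have split_in (W : {set T}) : (W \subset x |: B) && (x \notin W) = (W \subset B).
  apply/andP/idP => [[/subsetP WB xW]|WB]; last first.
    rewrite (subset_trans WB (subsetUr _ _)); split=> //.
    by apply: contra xB; apply: (subsetP WB).
  apply/subsetP => y yW; move: (WB y yW); rewrite !inE => /orP[/eqP eyx|//].
  by rewrite -eyx yW in xW.
congr (_ + _); last first.
  rewrite (eq_bigl _ _ split_in) mulr_sumr; apply: eq_bigr => W WB.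
  rewrite big_setU1 //= mulrA; congr (_ * _ * _).
  by rewrite ifN //; apply: contra xB; apply: (subsetP WB).
rewrite (reindex_onto (fun W => x |: W) (fun W => W :\ x)) /=; last first.
  by move=> W /andP[_ xW]; rewrite setD1K.
rewrite mulr_sumr; apply: eq_big => [W|W].
  rewrite setU11 andbT; apply/andP/idP => [[WB /eqP <-]|WB].
    by rewrite subDset.
  by rewrite setUS // setU1K // (contra _ xB) //; apply: (subsetP WB).
rewrite setU11 andbT => /andP[WB /eqP WE].
rewrite big_setU1 //= setU11 mulrA; congr (_ * _ * _).
apply: eq_bigr => y yB; rewrite !inE; case: eqP => [yx|//].
by rewrite yx (negPf xB) in yB.
Qed.

Lemma expose_enum q (B : {set T}) (G : {set T} -> R) :
  expose q (enum B) (fun s => G [set x in s]) = setprob q B G.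
Proof.
have expose_uniq s : uniq s -> forall G : {set T} -> R,
    expose q s (fun s => G [set x in s]) = setprob q [set x in s] G.
  elim: s => [_ G'|x s IH /= /andP[xs us] G'] /=.
    by rewrite set_nil setprob0.
  rewrite set_cons setprobU1 ?inE // -!IH //; congr (_ * _ + _).
  by apply: eq_expose => s'; rewrite set_cons.
by rewrite expose_uniq ?enum_uniq // set_enum.
Qed.

End Expose.

(** * Fragments of a spread family *)

Section SetProb.
Variables (R : realFieldType) (T : finType) (q : R).
Hypothesis q01 : 0 <= q <= 1.
Implicit Types (B : {set T}) (G : {set T} -> R).

Lemma setprob_ge0 B G : (forall W, 0 <= G W) -> 0 <= setprob q B G.
Proof.
move=> G0; case/andP: q01 => q0 q1; apply: sumr_ge0 => W _; apply: mulr_ge0 => //.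
by apply: prodr_ge0 => x _; case: ifP => _; rewrite ?subr_ge0.
Qed.

Lemma ler_setprob B G G' : (forall W : {set T}, W \subset B -> G W <= G' W) ->
  setprob q B G <= setprob q B G'.
Proof.
move=> leG; case/andP: q01 => q0 q1; apply: ler_sum => W WB.
apply: ler_wpM2l; last exact: leG.
by apply: prodr_ge0 => x _; case: ifP => _; rewrite ?subr_ge0.
Qed.

Lemma setprob_const B (a : R) : setprob q B (fun=> a) = a.
Proof. by rewrite -(expose_enum q B (fun=> a)) expose_const. Qed.

Lemma setprobZ B (a : R) G : setprob q B (fun W => a * G W) = a * setprob q B G.
Proof. by rewrite /setprob mulr_sumr; apply: eq_bigr => W _; rewrite mulrCA. Qed.

Lemma setprobD B G G' :
  setprob q B (fun W => G W + G' W) = setprob q B G + setprob q B G'.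
Proof. by rewrite /setprob -big_split; apply: eq_bigr => W _; rewrite mulrDr. Qed.

Lemma setprob_sum (I : finType) (P : pred I) B (G : I -> {set T} -> R) :
  setprob q B (fun W => \sum_(i | P i) G i W) = \sum_(i | P i) setprob q B (G i).
Proof.
by rewrite /setprob exchange_big; apply: eq_bigr => W _; rewrite mulr_sumr.
Qed.

(** Substitute Z = W :|: A, which is injective on the sets W disjoint from A. The weight on A
    changes from (1 - q)^|A| to q^|A|, so the prefactor supplies the new weight and the leftover (1
    - q)^|A| is at most 1. *)
Lemma setprob_shift B (A : {set T}) G : A \subset B -> (forall W, 0 <= G W) ->
  q ^+ #|A| * setprob q B (fun W => [disjoint W & A]%:R * G (W :|: A)) <=
  setprob q B G.
Proof.
move=> AB G0; case/andP: q01 => q0 q1.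
have wt0 (W : {set T}) : 0 <= \prod_(x in B) (if x \in W then q else 1 - q).
  by apply: prodr_ge0 => x _; case: ifP => _; rewrite ?subr_ge0.
rewrite /setprob mulr_sumr [leRHS](bigID (fun Z : {set T} => A \subset Z)) /=.
rewrite -[leLHS]addr0; apply: lerD; last by apply: sumr_ge0 => W _; apply: mulr_ge0.
rewrite [leRHS](reindex_onto (fun W : {set T} => W :|: A) (fun Z => Z :\: A)) /=; last first.
  by move=> Z /andP[_ AZ]; rewrite setUC -[RHS](setID Z A) (setIidPr AZ).
rewrite [leLHS](bigID (fun W : {set T} => [disjoint W & A])) /= [X in _ + X]big1 ?addr0; last first.
  by move=> W /andP[_ /negPf->]; rewrite mul0r !mulr0.
rewrite [leRHS](eq_bigl (fun W : {set T} => (W \subset B) && [disjoint W & A])); last first.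
  move=> W; rewrite subUset AB subsetUr !andbT; congr (_ && _).
  rewrite setDUl setDv setU0; apply/eqP/idP => [<-|WA]; last by apply/setDidPl.
  by rewrite -setI_eq0 setIDAC setDIl setDv setI0.
apply: ler_sum => W /andP[WB WA]; rewrite WA mul1r mulrA; apply: ler_wpM2r => //.
rewrite [X in _ * X](big_setID A) /= [leRHS](big_setID A) /= (setIidPr AB) mulrA.
have /eqP <- : \prod_(i in B :\: A) (if i \in W :|: A then q else 1 - q) ==
               \prod_(i in B :\: A) (if i \in W then q else 1 - q).
  apply/eqP; apply: eq_bigr => x; rewrite !inE => /andP[/negPf-> _].
  by rewrite orbF.
apply: ler_wpM2r.
  by apply: prodr_ge0 => x _; case: ifP => _; rewrite ?subr_ge0.
rewrite -prodr_const -big_split /=; apply: ler_prod => x xA.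
have xW : x \notin W by apply: contraL WA => xW; apply/pred0Pn; exists x; rewrite /= xW.
by rewrite !inE xA orbT (negPf xW) mulr_ge0 ?subr_ge0 //= ler_piMr // gerBl.
Qed.

End SetProb.

Section Fragment.
Variables (R : realFieldType) (T I : finType).
Variables (q kappa K : R) (B : {set T}).
Hypotheses (q01 : 0 <= q <= 1) (qkappa : 4 <= q * kappa) (K0 : 0 < K).

Section OneLayer.
Variables (J : {set I}) (S : I -> {set T}) (h : nat).
Hypothesis h0 : (0 < h)%N.
Hypothesis SB : forall i, i \in J -> S i \subset B.
Hypothesis Ssmall : forall i, i \in J -> (#|S i| < h.*2)%N.
Hypothesis spread : forall A : {set T},
  #|[set i in J | A \subset S i]|%:R * kappa ^+ #|A| <= K.

(** The minimum fragment of Park and Pham; [i] itself is always an admissible candidate for the arg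
    min. *)
Definition fragment (W : {set T}) (i : I) : {set T} :=
  S [arg min_(j < i | (j \in J) && (S j \subset W :|: S i)) #|S j :\: W|] :\: W.

Lemma fragmentP W i : i \in J ->
  [/\ fragment W i \subset S i,
      exists2 j, j \in J & S j \subset W :|: fragment W i &
      forall j, j \in J -> S j \subset W :|: S i ->
        (#|fragment W i| <= #|S j :\: W|)%N].
Proof.
move=> iJ; rewrite /fragment; case: arg_minnP; first by rewrite iJ subsetUr.
move=> j /andP[jJ jW] minj; split; first by rewrite subDset.
  by exists j => //; rewrite -subDset.
by move=> j' j'J j'W; apply: minj; rewrite j'J.
Qed.

(** Depends on [Z] alone. For [i] in [J] the default [set0] never occurs at
    [Z = W :|: fragment W i], which contains a member of the family. *)
Definition representative (Z : {set T}) : {set T} :=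
  if [pick i in J | S i \subset Z] is Some i then S i else set0.

Lemma card_representative Z : (#|representative Z| <= h.*2)%N.
Proof.
rewrite /representative; case: pickP => [i /andP[iJ _]|_]; last by rewrite cards0.
by apply: ltnW; apply: Ssmall.
Qed.

(* Minimality of the fragment forces every member of the family inside
   [W :|: fragment W i] to contain it, so [fragment W i] is one of the few
   subsets of a set that depends on [W :|: fragment W i] only. *)
Lemma fragment_representative W i : i \in J ->
  fragment W i \subset representative (W :|: fragment W i).
Proof.
move=> iJ; have [subS [j jJ jW] minf] := fragmentP W iJ.
rewrite /representative; case: pickP => [j' /andP[j'J j'W]|/(_ j)]; last by rewrite jJ jW.
have subf : S j' :\: W \subset fragment W i by rewrite subDset.
have /eqP <- : S j' :\: W == fragment W i.
  by rewrite eqEcard subf minf // (subset_trans j'W) // setUS.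
exact: subsetDl.
Qed.

(** Sum over the possible values A of the fragments and pass to Z = W :|: A, at a cost of q^-|A|.
    For fixed Z, A is one of at most 4^h subsets of [representative Z], and by spreadness at most K
    kappa^-|A| members contain it. As |A| >= h and q kappa >= 4, the total is at most K (4 / (q
    kappa))^h, where h > 0. *)
Lemma expected_large_fragments :
  setprob q B (fun W => #|[set i in J | (h <= #|fragment W i|)%N]|%:R) <=
  K * (4 / (q * kappa)).
Proof.
have [q0 q1] := andP q01; have qk0 : 0 < q * kappa by apply: lt_le_trans qkappa.
have qgt0 : 0 < q by rewrite lt0r q0 andbT; apply: contraTneq qk0 => ->; rewrite mul0r ltxx.
pose large (A : {set T}) := (h <= #|A|)%N.
(* The event that A is a fragment is relaxed to one that depends on W :|: A only, so that
   [setprob_shift] applies. *)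
pose ind (A Z : {set T}) : R := (A \subset representative Z)%:R.
have count_le W : #|[set i in J | large (fragment W i)]|%:R <=
    \sum_(i in J) \sum_(A : {set T} | large A && (A \subset S i))
      [disjoint W & A]%:R * ind A (W :|: A).
  rewrite -sum1_card natr_sum.
  rewrite (eq_bigl (fun i => (i \in J) && large (fragment W i))); last by move=> i; rewrite inE.
  rewrite big_mkcondr /=; apply: ler_sum => i iJ.
  case: ifP => lf; last first.
    by apply: sumr_ge0 => A _; rewrite mulr_ge0 ?ler0n.
  have [subS _ _] := fragmentP W iJ.
  rewrite (bigD1 (fragment W i)) ?lf ?subS //= /ind fragment_representative //.
  have -> : [disjoint W & fragment W i].
    by rewrite -setI_eq0 /fragment setIDA setIC -setIDA setDv setI0.
  by rewrite mulr1 lerDl sumr_ge0 // => A _; rewrite mulr_ge0 ?ler0n.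
apply: le_trans (ler_setprob q01 (fun W _ => count_le W)) _.
rewrite setprob_sum.
have step i : i \in J -> setprob q B (fun W =>
      \sum_(A : {set T} | large A && (A \subset S i)) [disjoint W & A]%:R * ind A (W :|: A))
    <= setprob q B (fun Z => \sum_(A : {set T} | large A && (A \subset S i))
         q ^- #|A| * ind A Z).
  move=> iJ; rewrite !setprob_sum; apply: ler_sum => A /andP[_ AS].
  rewrite setprobZ -ler_pdivrMl ?invr_gt0 ?exprn_gt0 // invrK.
  by apply: setprob_shift => //; rewrite (subset_trans AS) ?SB.
apply: le_trans (ler_sum _ step) _; rewrite -setprob_sum.
have repr_le Z : \sum_(i in J) \sum_(A : {set T} | large A && (A \subset S i))
    q ^- #|A| * ind A Z <= K * (4 / (q * kappa)).
  rewrite (exchange_big_dep large) /=; last by move=> i A _ /andP[].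
  apply: (@le_trans _ _ (\sum_(A in powerset (representative Z)) K * (q * kappa) ^- h)).
    rewrite [leLHS](bigID (mem (powerset (representative Z)))) /= [X in _ + X]big1 ?addr0.
      rewrite [leLHS]big_mkcond [leRHS]big_mkcond /=; apply: ler_sum => A _.
      rewrite powersetE; case: (A \subset representative Z) / idP => [Arep|_]; last by rewrite andbF.
      rewrite andbT; case: ifP => lA; last first.
        by rewrite mulr_ge0 ?invr_ge0 ?exprn_ge0 ?(ltW K0) ?(ltW qk0).
      rewrite (eq_bigr (fun=> q ^- #|A|)); last by move=> i _; rewrite /ind Arep mulr1.
      rewrite sumr_const (eq_card (B := [set i in J | A \subset S i])); last first.
        by move=> i; rewrite !inE unfold_in lA.
      apply: (@le_trans _ _ (K * (q * kappa) ^- #|A|)).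
        rewrite exprMn invfM mulrCA -[leLHS]mulr_natr; apply: ler_wpM2l.
          by rewrite invr_ge0 exprn_ge0.
        have kgt0 : 0 < kappa by rewrite -(pmulr_rgt0 _ qgt0).
        by rewrite ler_pdivlMr ?exprn_gt0 // spread.
      apply: ler_wpM2l; first exact: ltW.
      rewrite lef_pV2 ?posrE ?exprn_gt0 // ler_weXn2l // (le_trans _ qkappa) // ler1n //.
    move=> A /andP[_ Arep]; apply: big1 => i _.
    by rewrite /ind -powersetE (negPf Arep) mulr0.
  rewrite sumr_const card_powerset -mulrnAr; apply: ler_wpM2l; first exact: ltW.
  apply: (@le_trans _ _ ((4 / (q * kappa)) ^+ h)).
    rewrite expr_div_n -[leLHS]mulr_natl natrX; apply: ler_wpM2r.
      by rewrite invr_ge0 exprn_ge0 // ltW.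
    have -> : 4 = 2%:R ^+ 2 :> R by rewrite -natrX.
    rewrite -exprM ler_weXn2l ?ler1n // mul2n; exact: card_representative.
  case: h h0 => // h' _; rewrite exprS ler_piMr ?divr_ge0 ?(ltW qk0) ?ler0n //.
  apply: exprn_ile1; first by rewrite divr_ge0 ?(ltW qk0) ?ler0n.
  by rewrite ler_pdivrMr // mul1r.
apply: le_trans (ler_setprob q01 (fun Z _ => repr_le Z)) _.
by rewrite setprob_const.
Qed.

End OneLayer.

Variable Q : pred {set T}.
Hypothesis Qmono : forall A A' : {set T}, A \subset A' -> Q A -> Q A'.

(** Induction on the layers: each one replaces the members by their fragments, which halves the size
    bound, and discards those whose fragment is still large, in expectation at most a fraction 4 /
    (q kappa) of [K]. Fragments are subsets, so spreadness persists with the same [K] and kappa;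
    after the last layer any surviving set is empty. *)
Lemma layers_miss f (J : {set I}) (S : I -> {set T}) (W0 : {set T}) :
  (forall i, i \in J -> S i \subset B) ->
  (forall i, i \in J -> (#|S i| < 2 ^ f)%N) ->
  (forall A : {set T}, #|[set i in J | A \subset S i]|%:R * kappa ^+ #|A| <= K) ->
  (forall i, i \in J -> Q (W0 :|: S i)) ->
  expose q (layers f B) (fun s => (~~ Q (W0 :|: [set x in s]))%:R) <=
  1 - #|J|%:R / K + f%:R * (4 / (q * kappa)).
Proof.
elim: f J S W0 => [|f IH] J S W0 SB Ssmall spread QS.
  rewrite /layers /= mul0r addr0 set_nil setU0.
  have [J0|[i iJ]] := set_0Vmem J; first by rewrite J0 cards0 mul0r subr0 lern1; case: Q.
  have := QS i iJ; have := Ssmall i iJ; rewrite ltnS leqn0 cards_eq0 => /eqP->.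
  rewrite setU0 => -> /=; rewrite subr_ge0 ler_pdivrMr // mul1r.
  (* Spreadness at the empty set says that [J] has at most [K] members. *)
  have := spread set0; rewrite cards0 expr0 mulr1; apply: le_trans.
  by rewrite ler_nat subset_leq_card //; apply/subsetP => j jJ; rewrite inE jJ sub0set.
rewrite /layers /= expose_cat -/(layers f B).
pose G (W : {set T}) :=
  expose q (layers f B) (fun s => (~~ Q (W0 :|: W :|: [set x in s]))%:R).
rewrite (@eq_expose _ _ _ _ _ (fun s => G [set x in s])); last first.
  move=> s; apply: eq_expose => s'; congr (~~ Q _)%:R.
  by apply/setP => x; rewrite !inE mem_cat orbA.
rewrite expose_enum.
pose h := (2 ^ f)%N.
pose bad W := [set i in J | (h <= #|fragment J S W i|)%N].
have GE W : G W <= 1 - #|J|%:R / K + f%:R * (4 / (q * kappa)) + K^-1 * #|bad W|%:R.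
  have frag_sub i : i \in J :\: bad W ->
      [/\ i \in J, (#|fragment J S W i| < h)%N & fragment J S W i \subset S i].
    rewrite !inE negb_and -ltnNge => /andP[/orP[/negPf->//|lt] iJ]; split=> //.
    by case: (fragmentP S W iJ).
  apply: le_trans (IH (J :\: bad W) (fragment J S W) (W0 :|: W) _ _ _ _) _.
  - by move=> i /frag_sub[iJ _ /subset_trans]; apply; apply: SB.
  - by move=> i /frag_sub[].
  - move=> A; apply: le_trans (spread A); apply: ler_wpM2r.
      rewrite exprn_ge0 // leNgt; apply/negP => k0; have [q0 _] := andP q01.
      by have := le_trans qkappa (mulr_ge0_le0 q0 (ltW k0)); rewrite lern0.
    rewrite ler_nat subset_leq_card //; apply/subsetP => i.
    rewrite inE => /andP[/frag_sub[iJ _ fS] /subset_trans Af].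
    by rewrite inE iJ Af.
  - move=> i /frag_sub[iJ _ _]; have [_ [j jJ jW] _] := fragmentP S W iJ.
    apply: Qmono (QS j jJ); rewrite -setUA setUS //.
  have -> : #|J :\: bad W|%:R = #|J|%:R - #|bad W|%:R :> R.
    rewrite cardsD (setIidPr _) ?natrB ?subset_leq_card //; apply/subsetP => i; rewrite inE => /andP[] //.
  by rewrite mulrBl [K^-1 * _]mulrC; lra.
apply: le_trans (ler_setprob q01 (fun W _ => GE W)) _.
rewrite setprobD setprobZ setprob_const.
have big0 : (0 < h)%N by rewrite expn_gt0.
have Ssm i : i \in J -> (#|S i| < h.*2)%N by move=> /Ssmall; rewrite expnS mul2n.
have := expected_large_fragments big0 SB Ssm spread.
rewrite -(ler_pM2l (_ : 0 < K^-1)) ?invr_gt0 // mulKf ?gt_eqF //.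
rewrite -/(bad _) -[f.+1%:R]natr1; lra.
Qed.

End Fragment.

(** * Perfect matchings of balanced vertex sets *)

Section Kpartite.
Variables (k n : nat).
Hypothesis k0 : (0 < k)%N.
Local Notation T := {set vertex k n}.
Implicit Types (A e : {set vertex k n}) (M S : {set {set vertex k n}}) (b : nat).
Local Open Scope nat_scope.

Definition part A i := [set v in A | v.1 == i].
Definition balanced A b := [forall i, #|part A i| == b].
Definition edges A := [set e in complete_kpartite k n | e \subset A].
Definition matchings A : {set {set T}} :=
  [set M : {set T} | [&& M \subset edges A, trivIset M & cover M == A]].

Lemma balancedT : balanced [set: vertex k n] n.
Proof.
apply/forallP => i; rewrite -[X in _ == X]card_ord -cardsT.
rewrite -(card_imset _ (_ : injective (pair i : 'I_n -> vertex k n))); last by move=> ? ? [].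
apply/eqP/eq_card => -[i' j]; rewrite !inE /=; apply/eqP/imsetP => [->|[j' _ [-> _]] //].
by exists j.
Qed.

Lemma edge_part e i : e \in complete_kpartite k n -> #|part e i| = 1.
Proof. by rewrite inE => /forallP/(_ i)/eqP. Qed.

Lemma edge_neq0 e : e \in complete_kpartite k n -> e != set0.
Proof.
move=> eK; apply/negP => /eqP e0; have := edge_part (Ordinal k0) eK.
by rewrite e0 /part; move/eqP; rewrite (eq_card0 (_ : _ =i pred0)) // => v; rewrite !inE.
Qed.

(** Edges inside [A] are the graphs of the functions that choose one vertex of [A] in every part. *)
Lemma card_edges A : #|edges A| = \prod_i #|part A i|.
Proof.
pose graph (f : {ffun 'I_k -> 'I_n}) : {set vertex k n} := [set v | v.2 == f v.1].
have graph_inj : injective graph.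
  move=> f g /setP fg; apply/ffunP => i; have := fg (i, f i).
  by rewrite !inE /= eqxx => /esym/eqP.
pose F i := [pred j | (i, j) \in A].
have -> : edges A = graph @: [set f in family F].
  apply/setP => e; rewrite inE; apply/andP/imsetP => [[eK eA]|[f]].
    have ex i : exists j, part e i == [set ((i, j) : vertex k n)].
      have /cards1P[v eE] : #|part e i| == 1 by rewrite edge_part.
      have : v \in part e i by rewrite eE set11.
      rewrite inE => /andP[_ /eqP vi]; exists v.2; rewrite eE -vi.
      by rewrite -surjective_pairing.
    have [f fE] : exists f : {ffun 'I_k -> 'I_n}, forall i, part e i = [set ((i, f i) : vertex k n)].
      by exists [ffun i => xchoose (ex i)] => i; rewrite ffunE; apply/eqP/(xchooseP (ex i)).
    have eE (v : vertex k n) : (v \in e) = (v.2 == f v.1).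
      have := fE v.1 => /setP/(_ v); rewrite !inE eqxx andbT => ->.
      by case: v => i j /=; rewrite xpair_eqE eqxx.
    exists f; last by apply/setP => v; rewrite inE.
    by rewrite inE; apply/familyP => i; rewrite inE; apply: (subsetP eA); rewrite eE.
  rewrite inE => /familyP fF ->; split.
    rewrite inE; apply/forallP => i; apply/cards1P; exists (i, f i).
    apply/setP => -[i' j]; rewrite !inE xpair_eqE /= andbC.
    by case: eqP => // ->.
  apply/subsetP => -[i j]; rewrite inE /= => /eqP ->.
  by have := fF i; rewrite inE.
rewrite card_imset // cardsE card_family foldrE big_map enumT; apply: eq_bigr => i _.
rewrite -[LHS](card_imset _ (_ : injective (pair i : 'I_n -> vertex k n))); last by move=> ? ? [].
apply: eq_card => -[i' j]; rewrite !inE /=; apply/imsetP/andP => [[j' jA [-> ->]]|[ijA /eqP ii']].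
  by split.
by exists j; rewrite -ii'.
Qed.

Lemma card_balanced_edges A b : balanced A b -> #|edges A| = b ^ k.
Proof.
move=> /forallP bA; rewrite card_edges (eq_bigr (fun=> b)) ?prod_nat_const ?card_ord //.
by move=> i _; apply/eqP.
Qed.

Lemma card_complete_kpartite : #|complete_kpartite k n| = n ^ k.
Proof.
rewrite -(card_balanced_edges balancedT); apply: eq_card => x.
by rewrite [RHS]inE subsetT andbT.
Qed.

Lemma balanced_setD A b e : balanced A b -> e \in edges A -> balanced (A :\: e) b.-1.
Proof.
move=> /forallP bA; rewrite inE => /andP[eK eA]; apply/forallP => i.
have -> : part (A :\: e) i = part A i :\: part e i.
  by apply/setP => v; rewrite !inE; case: (v.1 == i); rewrite ?andbT ?andbF.
rewrite cardsD (setIidPr _) ?(edge_part i eK) ?(eqP (bA i)) ?subn1 //.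
by apply/subsetP => v; rewrite !inE => /andP[/(subsetP eA)-> ->].
Qed.

Lemma edgesD A e x : x \in edges (A :\: e) = (x \in edges A) && [disjoint x & e].
Proof. by rewrite !inE subsetD andbA. Qed.

Lemma edges_disjoint A e : e \in edges A ->
  [set y in edges A | e \subset A :\: y] = edges (A :\: e).
Proof.
move=> eE; apply/setP => y; rewrite inE edgesD; congr (_ && _).
by move: eE; rewrite subsetD disjoint_sym inE => /andP[_ ->].
Qed.

Lemma edges_set0 A : balanced A 0 -> edges A = set0.
Proof. by move=> /card_balanced_edges/eqP; rewrite exp0n // cards_eq0 => /eqP. Qed.

Lemma matchingsU1 A e : e \in edges A ->
  [set M in matchings A | e \in M] = (fun M => e |: M) @: matchings (A :\: e).
Proof.
move=> eE; have /andP[eK eA] : (e \in complete_kpartite k n) && (e \subset A) by rewrite inE in eE.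
apply/setP => M; rewrite inE; apply/andP/imsetP => [[]|[M' + ->]].
  rewrite inE => /and3P[ME tM /eqP cM] eM; exists (M :\ e); last by rewrite setD1K.
  have dis x : x \in M :\ e -> [disjoint x & e].
    by rewrite !inE => /andP[nxe xM]; apply: (trivIsetP tM).
  rewrite inE trivIsetD // andTb; apply/andP; split.
    by apply/subsetP => x xMe; rewrite edgesD dis // (subsetP ME) //; move: xMe; rewrite inE => /andP[].
  have := cM; rewrite /cover (big_setD1 e) //= => <-.
  rewrite setDUl setDv set0U; apply/eqP/esym/setDidPl; rewrite -setI_eq0 -subset0.
  apply/subsetP => v /setIP[/bigcupP[x xMe vx] ve].
  by have /pred0P/(_ v) := dis x xMe; rewrite /= vx ve.
rewrite inE => /and3P[ME tM /eqP cM].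
have dis x : x \in M' -> [disjoint e & x].
  by move=> /(subsetP ME); rewrite edgesD disjoint_sym => /andP[].
have n0 : set0 \notin M'.
  apply/negP => /(subsetP ME); rewrite !inE => /andP[K0 _].
  by have := edge_neq0 (e := set0); rewrite inE K0 eqxx => /(_ isT).
have [tU eM'] := trivIsetU1 dis tM n0; split; last exact: setU11.
rewrite inE tU andTb; apply/andP; split.
  rewrite subUset sub1set eE; apply/subsetP => x /(subsetP ME).
  by rewrite edgesD => /andP[].
rewrite /cover big_setU1 //= -/(cover M') cM.
by rewrite -{2}(setID A e) (setIidPr eA).
Qed.

Lemma matchings_notin A e M : e \in complete_kpartite k n -> M \in matchings (A :\: e) -> e \notin M.
Proof.
move=> eK; rewrite inE => /and3P[ME _ _]; apply/negP => /(subsetP ME).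
by rewrite edgesD => /andP[_]; rewrite -setI_eq0 setIid (negPf (edge_neq0 eK)).
Qed.

Lemma card_matchingsU1 A e : e \in edges A ->
  #|[set M in matchings A | e \in M]| = #|matchings (A :\: e)|.
Proof.
move=> eE; have eK : e \in complete_kpartite k n by move: eE; rewrite inE => /andP[].
rewrite matchingsU1 // card_in_imset // => M M' MA M'A eMM'.
by rewrite -(setU1K (matchings_notin eK MA)) eMM' setU1K // (matchings_notin eK M'A).
Qed.

(** A fixed vertex [v] of the first part lies in exactly one edge of the matching, and with b + 1
    vertices per part there are (b + 1)^(k - 1) candidates for that edge. *)
Lemma card_matchings A b : balanced A b -> #|matchings A| = b`! ^ k.-1.
Proof.
elim: b A => [|b IH] A bA.
  have A0 : A = set0.
    apply/setP => v; rewrite inE; apply/negP => vA.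
    have := forallP bA v.1; rewrite cards_eq0 => /eqP/setP/(_ v).
    by rewrite !inE vA eqxx.
  rewrite fact0 exp1n; apply/eqP/cards1P; exists set0; apply/setP => M.
  rewrite !inE edges_set0 // subset0; case: eqP => // ->.
  by rewrite A0 /cover big_set0 eqxx andbT; apply/trivIsetP => ? ?; rewrite inE.
have [v vA] : exists v, v \in part A (Ordinal k0).
  by apply/set0Pn; rewrite -cards_eq0 (eqP (forallP bA _)).
(* Only [v] is kept in the first part, so the edges inside [A'] are the edges of [A] through [v]. *)
pose A' := A :\: (part A (Ordinal k0) :\ v).
have partA' i : #|part A' i| = if i == Ordinal k0 then 1 else b.+1.
  have := vA; rewrite inE => /andP[vA0 /eqP v0]; case: eqP => [->|ni].
    rewrite (_ : part A' _ = [set v]) ?cards1 //; apply/setP => u.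
    rewrite !inE; case: (u.1 =P _) => u0; rewrite ?andbF ?andbT; last first.
      by apply/esym/negbTE/eqP => uv; rewrite uv v0 in u0.
    by case: eqP => [->|_] /=; [rewrite vA0 | rewrite andNb].
  rewrite (_ : part A' i = part A i) ?(eqP (forallP bA i)) //; apply/setP => u.
  rewrite !inE; case: (u.1 =P i) => ui; rewrite ?andbF ?andbT //.
  have -> : (u.1 == Ordinal k0) = false by rewrite ui; apply/eqP.
  by rewrite !andbF.
have vA0 : v \in A by move: vA; rewrite inE => /andP[].
have edgesA' e : (e \in edges A) && (v \in e) = (e \in edges A').
  apply/andP/idP => [[]|].
    rewrite !inE => /andP[eK eA] ve; rewrite eK subsetD eA /=.
    rewrite -setI_eq0 -subset0; apply/subsetP => u; rewrite !inE.
    case/and4P => ue nuv uA /eqP u0.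
    have /cards1P[w eW] : #|part e (Ordinal k0)| == 1 by rewrite edge_part // inE.
    have : v \in part e (Ordinal k0) by move: vA; rewrite !inE ve => /andP[].
    have : u \in part e (Ordinal k0) by rewrite inE ue u0 eqxx.
    by rewrite eW !inE => /eqP uw /eqP vw; rewrite uw vw eqxx in nuv.
  rewrite !inE => /andP[eK eA']; have eA : e \subset A by apply: subset_trans eA' (subsetDl _ _).
  split; first by rewrite eK.
  have /cards1P[w eW] : #|part e (Ordinal k0)| == 1 by rewrite edge_part // inE.
  have : w \in part e (Ordinal k0) by rewrite eW set11.
  rewrite inE => /andP[we w0]; have := subsetP eA' w we.
  by rewrite !inE w0 (subsetP eA) // !andbT negbK => /eqP <-.
have -> : #|matchings A| = \sum_(e in edges A') #|[set M in matchings A | e \in M]|.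
  rewrite -sum1_card.
  under [RHS]eq_bigr => e _ do rewrite -sum1_card.
  rewrite (exchange_big_dep [in matchings A]) /=; last by move=> e M _; rewrite inE => /andP[].
  apply: eq_bigr => M MA; have := MA; rewrite inE => /and3P[ME tM /eqP cM].
  have /bigcupP[e eM ve] : v \in cover M by rewrite cM.
  rewrite (big_pred1 e) // => x; rewrite [X in _ && X]inE MA andTb -edgesA'.
  apply/andP/eqP => [[/andP[_ vx] xM]|->]; last by rewrite ve eM (subsetP ME).
  apply/eqP; apply/negPn/negP => nxe; have := trivIsetP tM _ _ xM eM nxe.
  by move/pred0P/(_ v); rewrite /= vx ve.
rewrite (eq_bigr (fun=> b`! ^ k.-1)) => [|e]; last first.
  rewrite -edgesA' => /andP[eE _]; rewrite card_matchingsU1 // IH //.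
  exact: (balanced_setD bA eE).
rewrite sum_nat_const card_edges (bigD1 (Ordinal k0)) //= partA' eqxx mul1n.
rewrite (eq_bigr (fun=> b.+1)) => [|i /negPf ni]; last by rewrite partA' ni.
by rewrite prod_nat_const cardC1 card_ord factS expnMn.
Qed.

(** The edges of [S] are removed one at a time. The boolean factor is needed because truncated
    subtraction would give 0! = 1 when [S] is too large. *)
Lemma card_matchings_sup A b S : balanced A b ->
  #|[set M in matchings A | S \subset M]| <= (#|S| <= b) * (b - #|S|)`! ^ k.-1.
Proof.
move sE : #|S| => s; elim: s A b S sE => [|s IH] A b S sE bA.
  rewrite subn0 mul1n -(card_matchings bA) subset_leq_card //.
  by apply/subsetP => M; rewrite inE => /andP[].
have [e eS] : exists e, e \in S by apply/set0Pn; rewrite -cards_eq0 sE.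
have [eE|neE] := boolP (e \in edges A); last first.
  rewrite (eq_card0 (_ : _ =i pred0)) // => M; rewrite !inE; apply/negP.
  by move=> /andP[/and3P[/subsetP ME _ _] /subsetP SM]; rewrite (ME e) ?SM in neE.
have eK : e \in complete_kpartite k n by move: eE; rewrite inE => /andP[].
case: b bA => [|b] bA; first by rewrite edges_set0 ?inE in eE.
have := IH (A :\: e) b (S :\ e); rewrite ltnS subSS; move=> /(_ _ _)/(leq_trans _)-> //.
- set N := [set M in matchings (A :\: e) | _].
  apply: leq_trans (leq_imset_card (fun M => e |: M) N).
  apply: subset_leq_card; apply/subsetP => M; rewrite inE => /andP[MA SM].
  have : M \in [set M in matchings A | e \in M] by rewrite inE MA (subsetP SM).
  rewrite matchingsU1 // => /imsetP[M' M'A ME]; apply/imsetP; exists M' => //.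
  by rewrite inE M'A subDset -ME.
- by rewrite (cardsD1 e) eS in sE; case: sE.
- exact: (balanced_setD bA eE).
Qed.

End Kpartite.

(** * Spreadness of perfect matchings and the final completion *)

Section Leftover.
(* [E] stands for e, which an arbitrary ordered field lacks. *)
Variables (R : realFieldType) (E : R).
Hypothesis E_bound : forall b : nat, b.+1%:R ^+ b <= E * b%:R ^+ b.

Lemma E_ge1 : 1 <= E.
Proof. by have := E_bound 0; rewrite !expr0 mulr1. Qed.

(** For positive [b], (1 + 1/b)^s increases with s and is at most [E] at s = b. *)
Lemma succ_expr_le (b s : nat) : (s <= b)%N -> b.+1%:R ^+ s <= E * b%:R ^+ s.
Proof.
case: b => [|b] sb; first by move: sb; rewrite leqn0 => /eqP->; rewrite !expr0 mulr1 E_ge1.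
have b0 : 0 < b.+1%:R ^+ (b.+1 - s) :> R by rewrite exprn_gt0 // ltr0n.
rewrite -(ler_pM2r b0) -mulrA -exprD subnKC //; apply: le_trans (E_bound b.+1).
have -> : b.+2%:R ^+ b.+1 = b.+2%:R ^+ s * b.+2%:R ^+ (b.+1 - s) :> R.
  by rewrite -exprD subnKC.
rewrite ler_wpM2l ?exprn_ge0 ?ler0n //.
by apply: lerXn2r; rewrite ?nnegrE ?ler0n ?ler_nat.
Qed.

(** The falling factorial b (b - 1) ... (b - s + 1) is at least (b/E)^s; raised to the power k - 1,
    this is the spreadness of the matchings. *)
Lemma fact_spread (b s : nat) : (s <= b)%N ->
  b%:R ^+ s * (b - s)`!%:R <= E ^+ s * b`!%:R.
Proof.
elim: s b => [|s IH] b sb; first by rewrite subn0 !expr0 !mul1r.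
case: b sb => // b sb; rewrite subSS factS natrM !exprS.
have -> : E * E ^+ s * (b.+1%:R * b`!%:R) = b.+1%:R * (E * (E ^+ s * b`!%:R)) by ring.
rewrite -!mulrA ler_wpM2l ?ler0n //.
have E0 : 0 <= E by apply: le_trans E_ge1.
apply: le_trans (ler_wpM2l E0 (IH b sb)); rewrite mulrA ler_wpM2r ?ler0n //.
exact: succ_expr_le.
Qed.

(** Apply [layers_miss] to all perfect matchings of [A], with kappa = (b/E)^(k - 1) and [K] their
    exact number, so that the term 1 - |J| / K vanishes. *)
Lemma leftover_matching (k n : nat) (k0 : (0 < k)%N) (q : R) (A : {set vertex k n}) (b f : nat) :
  balanced A b -> (b < 2 ^ f)%N -> 0 <= q <= 1 -> 4 <= q * (b%:R / E) ^+ k.-1 ->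
  expose q (layers f (edges A))
    (fun s => (~~ [exists M in matchings A, M \subset [set x in s]])%:R) <=
  f%:R * (4 / (q * (b%:R / E) ^+ k.-1)).
Proof.
move=> bA bf q01 qk.
pose K : R := (b`! ^ k.-1)%:R.
pose Q (W : {set {set vertex k n}}) := [exists M in matchings A, M \subset W].
have K0 : 0 < K by rewrite ltr0n expn_gt0 fact_gt0.
have E0 : 0 < E by apply: lt_le_trans E_ge1.
have Emono (W W' : {set {set vertex k n}}) : W \subset W' -> Q W -> Q W'.
  move=> WW' /exists_inP[M MA MW]; apply/exists_inP; exists M => //.
  exact: subset_trans WW'.
have spread (S : {set {set vertex k n}}) :
    #|[set M in matchings A | S \subset M]|%:R * (b%:R / E) ^+ k.-1 ^+ #|S| <= K.
  have := card_matchings_sup k0 S bA; case: (leqP #|S| b) => [Sb|_].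
    rewrite mul1n -(ler_nat R) => le_card; apply: le_trans (ler_wpM2r _ le_card) _.
      by rewrite !exprn_ge0 // divr_ge0 ?ler0n ?(ltW E0).
    rewrite -exprM mulnC exprM natrX -exprMn /K natrX; apply: lerXn2r; rewrite ?nnegrE ?ler0n //.
      by rewrite mulr_ge0 ?ler0n // exprn_ge0 // divr_ge0 ?ler0n ?(ltW E0).
    rewrite expr_div_n mulrA ler_pdivrMr ?exprn_gt0 // mulrC [leRHS]mulrC.
    exact: fact_spread.
  by rewrite mul0n leqn0 => /eqP ->; rewrite mul0r ltW.
have size_lt M : M \in matchings A -> (#|M| < 2 ^ f)%N.
  move=> MA; apply: leq_ltn_trans bf; rewrite leqNgt; apply/negP => bM.
  have := card_matchings_sup k0 M bA; rewrite [(#|M| <= b)%N]leqNgt bM mul0n leqn0 cards_eq0.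
  by move/eqP/setP/(_ M); rewrite !inE subxx andbT => MA'; rewrite inE MA' in MA.
have := @layers_miss R _ _ q _ K (edges A) q01 qk K0 Q Emono f (matchings A) id set0.
rewrite /K (card_matchings k0 bA) divff ?gt_eqF // subrr add0r => miss.
rewrite (@eq_expose _ _ _ _ _ (fun s => (~~ Q (set0 :|: [set x in s]))%:R)).
  apply: miss => //; first by move=> M; rewrite inE => /andP[].
  by move=> M MA; rewrite set0U; apply/exists_inP; exists M.
by move=> s; rewrite set0U.
Qed.

End Leftover.

(** * Counting matchings up to coincidences *)

Section Packing.
Variables (k n : nat).
Hypotheses (k0 : (0 < k)%N) (n0 : (0 < n)%N).
Local Notation T := {set vertex k n}.
Implicit Types (s t : seq T) (g : nat).

(* Multiple occurrences of an edge in [s] may be shared by several matchings;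
   each such clash is paid for by a coincidence. *)
Definition packs g s := [exists F : {set {set T}},
  disjoint_perfect_matchings [set x in s] F && (g <= #|F| + coincidences s)%N].

Lemma perm_packs g : perm_inv (packs g).
Proof.
move=> s s' ss'; rewrite /packs (perm_coincidences ss').
by rewrite (_ : [set x in s] = [set x in s']) //; apply/setP => x; rewrite !inE (perm_mem ss').
Qed.

Lemma disjoint_perfect_matchingsS (H H' : {set T}) F : H \subset H' ->
  disjoint_perfect_matchings H F -> disjoint_perfect_matchings H' F.
Proof.
move=> HH' /andP[/forall_inP FH tF]; rewrite /disjoint_perfect_matchings tF andbT.
apply/forall_inP => M /FH /and3P[MH tM cM]; rewrite /perfect_matching tM cM !andbT.
exact: subset_trans HH'.
Qed.

Lemma packs_catl g t s : packs g s -> packs g (t ++ s).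
Proof.
elim: t => //= x t IH /IH{IH} /existsP[F /andP[FF gF]]; apply/existsP; exists F.
rewrite (disjoint_perfect_matchingsS _ FF) /=; last by rewrite set_cons subsetUr.
by rewrite (leq_trans gF) // leq_add2l coincidences_cons leq_addl.
Qed.

Lemma packs_leq g g' s : (g' <= g)%N -> packs g s -> packs g' s.
Proof.
move=> gg' /existsP[F /andP[FF gF]]; apply/existsP; exists F.
by rewrite FF (leq_trans gg').
Qed.

Lemma coincidences_cat_lt t s : has [in s] t ->
  (coincidences s < coincidences (t ++ s))%N.
Proof.
have mono t' : (coincidences s <= coincidences (t' ++ s))%N.
  elim: t' => //= x t' IH; rewrite coincidences_cons; apply: leq_trans IH _.
  exact: leq_addl.
elim: t => //= x t IH; rewrite coincidences_cons => /orP[xs|/IH lt]; last first.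
  by apply: leq_trans lt _; rewrite leq_addl.
rewrite -[X in (X < _)%N]add0n -addSn leq_add // count_cat addn_gt0.
by rewrite -!has_count !has_pred1 xs orbT.
Qed.

(** If [M] shares an edge with [s], a new coincidence pays for it and the packing stays as it is;
    otherwise [M] joins the packing. *)
Lemma packs_matching g s M : M \in matchings [set: vertex k n] ->
  packs g s -> packs g.+1 (enum M ++ s).
Proof.
rewrite inE => /and3P[ME tM cM].
have [/hasP[x xM xs] gs|/hasPn dis] := boolP (has [in s] (enum M)).
  have := packs_catl (enum M) gs.
  case/existsP: gs => F /andP[FF gF] _; apply/existsP; exists F.
  rewrite (disjoint_perfect_matchingsS _ FF) /=.
    apply: leq_trans (_ : #|F| + (coincidences s).+1 <= _)%N; first by rewrite addnS ltnS.
    by rewrite leq_add2l coincidences_cat_lt //; apply/hasP; exists x.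
  by apply/subsetP => y; rewrite !inE mem_cat orbC => ->.
case/existsP => F /andP[/andP[/forall_inP FF tF] gF]; apply/existsP; exists (M |: F).
have subF M' x : M' \in F -> x \in M' -> x \in s.
  by move=> /FF /and3P[/subsetP M's _ _] /M's; rewrite inE.
have disF : {in F, forall M' : {set T}, [disjoint M & M']}.
  move=> M' M'F; apply/pred0Pn => -[x /= /andP[xM xM']].
  by have := dis x; rewrite mem_enum xM => /(_ isT); rewrite /= (subF M').
have v0 : [set: vertex k n] != set0.
  by apply/set0Pn; exists (Ordinal k0, Ordinal n0).
have set0F : set0 \notin F.
  apply/negP => /FF /and3P[_ _]; rewrite /cover big_set0 => /eqP/esym/eqP.
  by rewrite (negPf v0).
have [tMF MF] := trivIsetU1 disF tF set0F.
rewrite /disjoint_perfect_matchings tMF andbT; apply/andP; split.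
  apply/forall_inP => M'; rewrite !inE => /orP[/eqP->|M'F].
    rewrite /perfect_matching tM cM !andbT; apply/subsetP => x xM.
    by rewrite inE mem_cat mem_enum xM.
  have /and3P[_ tM' cM'] := FF _ M'F; rewrite /perfect_matching tM' cM' !andbT.
  by apply/subsetP => x xM'; rewrite inE mem_cat (subF M') ?orbT.
rewrite cardsU1 MF add1n addSn ltnS (leq_trans gF) // leq_add2l.
elim: (enum M) => //= y t IH; rewrite coincidences_cons; apply: leq_trans IH _.
exact: leq_addl.
Qed.

Lemma packs_nil : packs 0 [::].
Proof.
apply/existsP; exists set0; rewrite /disjoint_perfect_matchings /= andbT.
apply/andP; split; first by apply/forall_inP => M; rewrite inE.
by apply/trivIsetP => ? ?; rewrite inE.
Qed.

End Packing.

(** * The sprinkling process *)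

Lemma perm_cat_exists (T : eqType) (l t : seq T) :
  (forall x, count_mem x l <= count_mem x t)%N -> exists t', perm_eq t (l ++ t').
Proof.
elim: l t => [|x l IH] t le_lt; first by exists t.
have xt : x \in t.
  by rewrite -has_pred1 has_count (leq_trans _ (le_lt x)) //= eqxx.
have [y|t' tt'] := IH (rem x t); last first.
  by exists t'; rewrite (permPl (perm_to_rem xt)) /= perm_cons.
have := le_lt y; rewrite (permP (perm_to_rem xt)) /=; lia.
Qed.

Section Process.
(** A round draws edges until [m] vertices per part are uncovered, then uses [f] coins of each
    uncovered edge; this completion fails with probability at most [eta]. There are [N] rounds, of
    which [d] may fail. The potential has base [lam], [c] is the allowance per step, and [beta] is
    the price of a failed round, chosen so that d + 1 failures cost at least 1. *)
Variables (R : realFieldType) (k n m f N d : nat) (q lam c eta beta : R).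
Hypotheses (k0 : (0 < k)%N) (m0 : (0 < m)%N) (mn : (m <= n)%N).
Hypotheses (q0 : 0 < q) (q1 : q <= 1) (lam1 : 1 <= lam) (c0 : 0 <= c).
Hypotheses (beta0 : 0 <= beta) (eta0 : 0 <= eta) (beta_d : 1 <= beta * d.+1%:R).

(* [1 + edge_rate b] bounds the expectation of [lam] to the number of coins that
   the current matching still spends on a given uncovered edge when [b] vertices
   per part are uncovered. The edge survives the next success with probability
   [((b - 1) / b) ^ k], whence the normalization by [b ^ k], and each step then
   costs the constant [c / q]; [lam ^ f - 1] pays for the final [f] coins. *)
Definition total_rate b : R := (lam ^+ f - 1) * m%:R ^+ k + c / q * (b%:R - m%:R).
Definition edge_rate b : R := total_rate b / b%:R ^+ k.

Hypothesis step_rate : forall b, (m <= b <= n)%N -> (lam - 1) * (1 + edge_rate b) <= c.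
Hypothesis leftover : forall A : {set vertex k n}, balanced A m ->
  expose q (layers f (edges A))
    (fun s => (~~ [exists M in matchings A, M \subset [set x in s]])%:R) <= eta.

Local Notation T := {set vertex k n}.
Local Notation K := (complete_kpartite k n).
Implicit Types (s t : seq T) (A : {set vertex k n}) (r lost : nat).

Let n0 : (0 < n)%N. Proof. exact: leq_trans mn. Qed.
Let q01 : 0 <= q <= 1. Proof. by rewrite ltW. Qed.

Definition miss s : R := (~~ packs (N - d) s)%:R.
Definition miss_prob s t : R := expose q t (fun s' => miss (s ++ s')).
(** Exponential in the number of coins spent, normalized to reach 1 exactly when no coin of [x] is
    left. *)
Definition weight t (x : T) : R := lam ^- count_mem x t.
Definition factor A b (x : T) : R := 1 + (x \subset A)%:R * edge_rate b.

(* [r] counts the matchings still to be started and [lost] those that could not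
   be completed, each of which costs [beta]. *)
Definition round_potential t r lost : R :=
  (\sum_(x in K) weight t x) * (1 + edge_rate n) ^+ r +
  beta * (lost%:R + r%:R * eta).

Definition potential t A b r lost : R :=
  (\sum_(x in K) weight t x * factor A b x) * (1 + edge_rate n) ^+ r +
  beta * (lost%:R + r.+1%:R * eta).

Lemma perm_miss : perm_inv miss.
Proof. by move=> s s' ss'; rewrite /miss (perm_packs _ ss'). Qed.

Lemma miss_prob_le1 s t : miss_prob s t <= 1.
Proof.
rewrite -[leRHS](expose_const q t); apply: ler_expose => // s'.
by rewrite /miss; case: packs; rewrite ?ler01.
Qed.

Lemma perm_miss_prob s s' t : perm_eq s s' -> miss_prob s t = miss_prob s' t.
Proof.
by move=> ss'; apply: eq_expose => s1; apply: perm_miss; rewrite perm_cat2r.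
Qed.

Lemma miss_prob_rem s t x : x \in t ->
  miss_prob s t = q * miss_prob (x :: s) (rem x t) + (1 - q) * miss_prob s (rem x t).
Proof.
move=> xt; rewrite /miss_prob (expose_rem _ (perm_inv_catl s perm_miss) xt) /=.
rewrite (@eq_expose _ _ _ _ (fun s' => miss (s ++ x :: s')) (fun s' => miss ((x :: s) ++ s'))) //.
by move=> s'; apply: perm_miss; rewrite (perm_catCA s [:: x]).
Qed.

Lemma total_rate_ge0 b : (m <= b)%N -> 0 <= total_rate b.
Proof.
move=> mb; rewrite addr_ge0 ?mulr_ge0 ?invr_ge0 ?exprn_ge0 ?ler0n ?(ltW q0) ?subr_ge0 //.
  by rewrite exprn_ege1.
by rewrite ler_nat.
Qed.

Lemma edge_rate_ge0 b : (m <= b)%N -> 0 <= edge_rate b.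
Proof. by move=> mb; rewrite divr_ge0 ?total_rate_ge0 ?exprn_ge0 ?ler0n. Qed.

Lemma edge_rateK b : (m <= b)%N -> edge_rate b * b%:R ^+ k = total_rate b.
Proof.
by move=> mb; rewrite divfK // expf_neq0 // pnatr_eq0 -lt0n (leq_trans m0).
Qed.

Lemma edge_rate_end : 1 + edge_rate m = lam ^+ f.
Proof.
rewrite /edge_rate /total_rate subrr mulr0 addr0 mulfK; first exact: subrKC.
by rewrite expf_neq0 // pnatr_eq0 -lt0n.
Qed.

Lemma lam_gt0 : 0 < lam. Proof. exact: lt_le_trans lam1. Qed.

Lemma lam_cancel i j : lam ^- (i + j) * lam ^+ i = lam ^- j.
Proof. by rewrite exprD invfM mulrAC mulVf ?mul1r // expf_neq0 // gt_eqF // lam_gt0. Qed.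

Lemma weight_ge0 t x : 0 <= weight t x.
Proof. by rewrite invr_ge0 exprn_ge0 // ltW // lam_gt0. Qed.

Lemma factor_ge1 A b x : (m <= b)%N -> 1 <= factor A b x.
Proof. by move=> mb; rewrite lerDl mulr_ge0 ?ler0n ?edge_rate_ge0. Qed.

Lemma round_factor_ge1 r : 1 <= (1 + edge_rate n) ^+ r.
Proof. by rewrite exprn_ege1 // lerDl edge_rate_ge0. Qed.

(** A single edge whose term reaches 1 makes the bound on a probability trivial; this disposes of
    edges with too few coins left. *)
Lemma potential_ge1 t A b r lost x : (m <= b)%N -> x \in K ->
  1 <= weight t x * factor A b x -> 1 <= potential t A b r lost.
Proof.
move=> mb xK wx; rewrite -[leLHS]addr0; apply: lerD; last first.
  by rewrite mulr_ge0 // addr_ge0 ?mulr_ge0 ?ler0n.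
rewrite -[leLHS]mulr1; apply: ler_pM; rewrite ?ler01 ?round_factor_ge1 //.
rewrite (bigD1 x) //=; apply: le_trans wx _; rewrite lerDl sumr_ge0 // => y _.
by rewrite mulr_ge0 ?weight_ge0 // (le_trans ler01) ?factor_ge1.
Qed.

(* A uniformly random [y] is tossed; if it succeeds, it is covered. *)
Lemma factor_step A b x : (m < b <= n)%N -> balanced A b -> x \in K ->
  \sum_(y in edges A) lam ^+ (x == y) *
     (q * factor (A :\: y) b.-1 x + (1 - q) * factor A b x) <=
  b%:R ^+ k * factor A b x.
Proof.
move=> /andP[mb bn] bA xK.
have [xA|xA] := boolP (x \subset A); last first.
  rewrite (eq_bigr (fun=> 1)) => [|y yE].
    by rewrite sumr_const (card_balanced_edges bA) /factor (negPf xA) mul0r addr0 mulr1 natrX.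
  have -> : (x == y) = false.
    by apply: contraNF xA => /eqP ->; move: yE; rewrite inE => /andP[].
  rewrite /factor (negPf xA) (_ : (x \subset A :\: y) = false); first by rewrite expr0 !mul0r; ring.
  by apply: contraNF xA => /subset_trans -> //; apply: subsetDl.
have xE : x \in edges A by rewrite inE xK.
have b1 : (m <= b.-1)%N by rewrite -ltnS (ltn_predK mb).
set a := edge_rate b; set a' := edge_rate b.-1.
(* The last summand is the surcharge for [y = x]: the toss costs a factor [lam], and a success
   removes [x] from the uncovered edges. *)
rewrite (eq_bigr (fun y => (1 + (1 - q) * a) + q * a' * (x \subset A :\: y)%:R +
    (y == x)%:R * ((lam - 1) * (1 + (1 - q) * a)))) => [|y yE]; last first.
  rewrite /factor xA -/a -/a' eq_sym; case: eqP => [->|_] /=; last by ring.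
  rewrite (_ : (x \subset A :\: x) = false); first by rewrite /=; ring.
  rewrite subsetD xA -setI_eq0 setIid; exact/negbTE/edge_neq0.
rewrite big_split big_split /= sumr_const (card_balanced_edges bA) -mulr_sumr.
rewrite -natr_sum -big_mkcondr /= sum1_card.
have -> : #|[pred y in edges A | x \subset A :\: y]| = (b.-1 ^ k)%N.
  rewrite -(card_balanced_edges (balanced_setD bA xE)) -(edges_disjoint xE).
  by apply: eq_card => y; rewrite !inE.
rewrite (bigD1 x) //= eqxx mul1r big1 ?addr0 => [|y /andP[_ /negPf->]]; last by rewrite mul0r.
rewrite -[_ *+ (b ^ k)]mulr_natr !natrX /factor xA mul1r -/a.
have Ea : a * b%:R ^+ k = total_rate b by apply/edge_rateK/ltnW.
have Ea' : a' * b.-1%:R ^+ k = total_rate b.-1 by apply: edge_rateK.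
rewrite -[q * a' * _]mulrA Ea'.
(* The drop of [total_rate] by c / q, multiplied by the success probability, gives exactly the [c]
   that pays for the surcharge. *)
have -> : q * total_rate b.-1 = q * (a * b%:R ^+ k) - c.
  rewrite Ea /total_rate (_ : b%:R = b.-1%:R + 1 :> R); first by field; rewrite gt_eqF.
  by rewrite natr1 prednK // (leq_ltn_trans _ mb).
have a0 : 0 <= a by apply/edge_rate_ge0/ltnW.
have la : (lam - 1) * (1 + (1 - q) * a) <= c.
  apply: le_trans (step_rate (_ : m <= b <= n)%N); last by rewrite (ltnW mb).
  rewrite -/a; apply: ler_wpM2l; first by rewrite subr_ge0.
  by rewrite lerD2l ler_piMl // gerBl ltW.
have -> : (1 + (1 - q) * a) * b%:R ^+ k + (q * (a * b%:R ^+ k) - c) + (lam - 1) * (1 + (1 - q) * a)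
  = b%:R ^+ k * (1 + a) + ((lam - 1) * (1 + (1 - q) * a) - c) by ring.
by rewrite gerDl subr_le0.
Qed.

(** Tossing a coin of [y] multiplies the weight of [y] alone by [lam], so [factor_step] applies edge
    by edge: on average over [y] the potential does not grow. *)
Lemma potential_step t A b r lost : (m < b <= n)%N -> balanced A b ->
  (forall x, x \in edges A -> x \in t) ->
  \sum_(y in edges A) (q * potential (rem y t) (A :\: y) b.-1 r lost +
    (1 - q) * potential (rem y t) A b r lost) <= b%:R ^+ k * potential t A b r lost.
Proof.
move=> mbn bA Et; rewrite /potential; set C := beta * _; set D := _ ^+ r.
have D1 : 1 <= D := round_factor_ge1 r.
rewrite (eq_bigr (fun y => (\sum_(x in K) weight t x * (lam ^+ (x == y) *
    (q * factor (A :\: y) b.-1 x + (1 - q) * factor A b x))) * D + C)) => [|y yE]; last first.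
  rewrite mulrDr [(1 - q) * (_ + _)]mulrDr addrACA -[q * C + _]mulrDl subrKC mul1r.
  congr (_ + C); rewrite !mulrA -mulrDl !mulr_sumr -big_split; congr (_ * D).
  apply: eq_bigr => x _; rewrite /weight.
  have -> : count_mem x t = ((x == y) + count_mem x (rem y t))%N.
    by rewrite (permP (perm_to_rem (Et y yE))) /= eq_sym.
  by rewrite [RHS]mulrA lam_cancel /= [RHS]mulrDr !(mulrCA (lam ^- _)).
rewrite big_split /= sumr_const (card_balanced_edges bA) -mulr_suml exchange_big /=.
rewrite mulrDr -[C *+ _]mulr_natl natrX lerD2r mulrA ler_wpM2r //.
  by rewrite (le_trans _ D1).
rewrite mulr_sumr; apply: ler_sum => x xK; rewrite -mulr_sumr mulrCA.
by apply: ler_wpM2l; rewrite ?weight_ge0 // factor_step.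
Qed.

(** The successes [s] already account for [g] matchings, so every one of the [N] rounds is secured,
    lost or still to come. *)
Definition round_bound r := forall t s g lost, (g + lost + r)%N = N ->
  packs g s -> miss_prob s t <= round_potential t r lost.

Lemma round_potential_ge0 t r lost : 0 <= round_potential t r lost.
Proof.
apply: addr_ge0; last by rewrite mulr_ge0 // addr_ge0 ?mulr_ge0 ?ler0n.
apply: mulr_ge0; first by apply: sumr_ge0 => x _; apply: weight_ge0.
by rewrite (le_trans ler01) ?round_factor_ge1.
Qed.

(** Either at most [d] rounds were lost and the target is met, or the price of the lost rounds alone
    is at least 1. *)
Lemma round_bound0 : round_bound 0.
Proof.
move=> t s g lost gN gs; case: (leqP lost d) => [ld|dl].
  have -> : miss_prob s t = 0; last exact: round_potential_ge0.
  rewrite -[RHS](expose_const q t); apply: eq_expose => s'.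
  rewrite /miss (_ : packs _ _) // (@packs_leq _ _ g) ?leq_subLR -?gN ?addn0 ?leq_add2l //.
    by rewrite addnC leq_add2r.
  by rewrite (perm_packs _ (_ : perm_eq _ (s' ++ s))) ?packs_catl // perm_catC.
apply: le_trans (miss_prob_le1 _ _) _; rewrite /round_potential mul0r addr0.
rewrite -[leLHS]add0r; apply: lerD.
  rewrite expr0 mulr1; apply: sumr_ge0 => x _; apply: weight_ge0.
by apply: le_trans beta_d _; rewrite ler_wpM2l // ler_nat.
Qed.

(** The next [f] layers of uncovered edges complete [M] except with probability [eta]. Completion
    raises [g], failure raises [lost] at price [beta], and the induction hypothesis covers the
    remaining rounds in both cases. *)
Lemma finish_round r t A (M : {set T}) s g lost : round_bound r ->
  balanced A m -> M \subset K -> trivIset M -> cover M = ~: A ->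
  (g + lost + r.+1)%N = N -> packs g s ->
  miss_prob (enum M ++ s) t <= potential t A m r lost.
Proof.
move=> IH bA MK tM cM gN gs.
(* An uncovered edge with fewer than [f] coins has a term of at least 1, since its factor is
   [lam ^+ f] at this stage. *)
have [/exists_inP[x xE]|/exists_inPn enough] := boolP [exists x in edges A, (count_mem x t < f)%N].
  move=> xf; apply: le_trans (miss_prob_le1 _ _) _; move: xE; rewrite inE => /andP[xK xA].
  apply: (@potential_ge1 _ _ _ _ _ x) => //; rewrite /factor xA mul1r edge_rate_end.
  rewrite /weight mulrC ler_pdivlMr ?exprn_gt0 ?lam_gt0 // mul1r.
  by rewrite ler_weXn2l // ltnW.
have [t' tt'] : exists t', perm_eq t (layers f (edges A) ++ t').
  apply: perm_cat_exists => x; rewrite count_layers.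
  by case: (boolP (x \in edges A)) => [/enough|_]; rewrite ?muln1 ?muln0 // -leqNgt.
pose hit s1 := [exists M1 in matchings A, M1 \subset [set x in s1 : seq T]].
(* Spending [f] coins of each uncovered edge multiplies its weight by [lam ^+ f], which its factor
   has already charged. *)
have -> : potential t A m r lost = round_potential t' r lost + beta * eta.
  rewrite /potential /round_potential -addrA; congr (_ * _ + _); last first.
    by rewrite -[r.+1%:R]natr1; ring.
  apply: eq_bigr => x xK; rewrite /weight (permP tt') count_cat count_layers.
  rewrite /factor inE xK /=; case: (x \subset A); last by rewrite muln0 add0n mul0r addr0 mulr1.
  by rewrite muln1 mul1r edge_rate_end lam_cancel.
apply: (@le_trans _ _ (expose q (layers f (edges A))
    (fun s1 => round_potential t' r lost + beta * (~~ hit s1)%:R))); last first.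
  by rewrite exposeD expose_const exposeZ lerD2l ler_wpM2l // leftover.
rewrite /miss_prob (expose_perm _ (perm_inv_catl _ perm_miss) tt') expose_cat.
apply: ler_expose => // s1.
rewrite (@eq_expose _ _ _ _ _ (fun s2 => miss ((s1 ++ enum M ++ s) ++ s2))); last first.
  move=> s2; apply: perm_miss; rewrite catA perm_cat2r perm_catC //.
rewrite -/(miss_prob _ _); case: (boolP (hit s1)) => [/exists_inP[M1 M1A M1s1]|_]; last first.
  rewrite mulr1; apply: le_trans (IH _ _ g lost.+1 _ _) _; first by rewrite -gN !(addnS, addSn).
    by rewrite catA packs_catl.
  by rewrite /round_potential -[lost.+1%:R]natr1 le_eqVlt; apply/orP; left; apply/eqP; ring.
rewrite mulr0 addr0; apply: (IH _ _ g.+1 lost); first by rewrite -gN !(addnS, addSn).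
move: M1A; rewrite inE => /and3P[M1E tM1 /eqP cM1].
have dis x y : x \in M -> y \in M1 -> [disjoint x & y].
  move=> xM yM1; rewrite disjoint_sym.
  have yA : y \subset A by have := subsetP M1E _ yM1; rewrite inE => /andP[].
  have xA : x \subset ~: A by rewrite -cM; apply: bigcup_sup.
  by rewrite -setI_eq0 -subset0 -(setICr A) setISS.
have MM1 : [disjoint M & M1].
  apply/pred0P => x /=; apply/negP => /andP[xM xM1].
  have := dis _ _ xM xM1; rewrite -setI_eq0 setIid; apply/negP/edge_neq0 => //.
  exact: (subsetP MK).
have MUA : M :|: M1 \in matchings [set: vertex k n].
  rewrite inE; apply/and3P; split.
  - apply/subsetP => x; rewrite inE => /orP[/(subsetP MK) xK|/(subsetP M1E)].
      by rewrite inE xK subsetT.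
    by rewrite !inE => /andP[-> _]; rewrite subsetT.
  - apply/trivIsetP => x y; rewrite !inE => /orP[xM|xM1] /orP[yM|yM1] nxy.
    + exact: (trivIsetP tM).
    + exact: dis.
    + by rewrite disjoint_sym dis.
    + exact: (trivIsetP tM1).
  - apply/eqP; rewrite /cover bigcup_setU -!/(cover _) cM cM1 setUC.
    exact: setUCr.
have [s1' ss1] : exists s1', perm_eq s1 (enum M1 ++ s1').
  apply: perm_cat_exists => x; rewrite count_uniq_mem ?enum_uniq // mem_enum.
  case: (boolP (x \in M1)) => // /(subsetP M1s1); rewrite inE -has_pred1 has_count //.
rewrite (perm_packs _ (_ : perm_eq _ (s1' ++ enum (M :|: M1) ++ s))); last first.
  rewrite (permPl (_ : perm_eq _ ((enum M1 ++ s1') ++ enum M ++ s))); last by rewrite perm_cat2r.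
  apply/permP => a; rewrite !count_cat addnACA [RHS]addnCA; congr (_ + _)%N.
  rewrite -count_cat; apply/permP/uniq_perm; rewrite ?cat_uniq ?enum_uniq //=.
    rewrite andbT; apply/hasPn => x; rewrite !mem_enum => xM.
    by apply/negP => xM1; have /pred0P/(_ x) := MM1; rewrite /= xM xM1.
  by move=> x; rewrite mem_cat !mem_enum inE orbC.
by rewrite packs_catl // packs_matching.
Qed.

(** Induction on the number of coins left: a success covers the vertices of an edge, a failure only
    consumes a coin. *)
Lemma draw_edges r t A b (M : {set T}) s g lost : round_bound r -> (m <= b <= n)%N ->
  balanced A b -> M \subset K -> trivIset M -> cover M = ~: A ->
  (g + lost + r.+1)%N = N -> packs g s ->
  miss_prob (enum M ++ s) t <= potential t A b r lost.
Proof.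
move=> IH; have [z zt] := ubnP (size t); elim: z => // z IHz in t zt A b M *.
move=> /andP[mb bn] bA MK tM cM gN gs.
have [bm|bm] := eqVneq b m; first by rewrite bm in bA *; apply: finish_round gs.
have bm' : (m < b)%N by rewrite ltn_neqAle eq_sym bm mb.
have mb' : (m < b <= n)%N by rewrite bm'.
have [/forall_inP Et|/forall_inPn[x xE xt]] := boolP [forall x in edges A, x \in t]; last first.
  apply: le_trans (miss_prob_le1 _ _) _; move: xE; rewrite inE => /andP[xK xA].
  apply: (@potential_ge1 _ _ _ _ _ x) => //; rewrite /weight (count_memPn xt) expr0 invr1 mul1r.
  exact: factor_ge1.
have b0 : 0 < b%:R ^+ k :> R by rewrite exprn_gt0 // ltr0n (leq_trans m0).
rewrite -(ler_pM2l b0); apply: le_trans (potential_step r lost mb' bA Et).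
(* The probability on the left does not depend on which coin is tossed first, so it equals its
   average over all uncovered edges [y]. *)
rewrite -natrX -(card_balanced_edges bA) mulr_natl -sumr_const; apply: ler_sum => y yE.
have zr : (size (rem y t) < z)%N.
  have yt := Et y yE; rewrite size_rem // -ltnS prednK //; by case: (t) yt.
rewrite (miss_prob_rem _ (Et y yE)); apply: lerD.
  apply: ler_wpM2l; first exact: ltW.
  have := yE; rewrite inE => /andP[yK yA].
  have dy x : x \in M -> [disjoint y & x].
    move=> xM; have xA : x \subset ~: A by rewrite -cM; apply: bigcup_sup.
    by rewrite -setI_eq0 -subset0 -(setICr A) setISS.
  have M0 : set0 \notin M.
    by apply/negP => /(subsetP MK)/(edge_neq0 k0); rewrite eqxx.
  have [tyM yM] := trivIsetU1 dy tM M0.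
  rewrite (perm_miss_prob (s' := enum (y |: M) ++ s)); last first.
    rewrite -cat_cons perm_cat2r; apply: uniq_perm; rewrite ?enum_uniq //=.
      by rewrite mem_enum yM enum_uniq.
    by move=> x; rewrite in_cons !mem_enum in_setU1.
  apply: IHz => //; first by rewrite -ltnS (ltn_predK bm') bm' (leq_trans (leq_pred b) bn).
  - exact: balanced_setD bA yE.
  - by rewrite subUset sub1set yK.
  - rewrite /cover big_setU1 //= -/(cover M) cM setDE setCI setCK; exact: setUC.
by apply: ler_wpM2l; rewrite ?subr_ge0 //; apply: IHz => //; rewrite mb.
Qed.

Lemma round_boundP r : round_bound r.
Proof.
elim: r => [|r IH]; first exact: round_bound0.
move=> t s g lost gN gs.
have -> : miss_prob s t = miss_prob (enum (set0 : {set T}) ++ s) t by rewrite enum_set0.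
apply: le_trans (draw_edges (A := [set: vertex k n]) (b := n) (M := set0) t IH _ _ _ _ _ gN gs) _.
- by rewrite mn leqnn.
- exact: balancedT.
- exact: sub0set.
- by apply/trivIsetP => ? ?; rewrite inE.
- by rewrite /cover big_set0 setCT.
(* At the start of a round all edges are uncovered and share the factor [1 + edge_rate n], which
   becomes one more power. *)
- rewrite /potential /round_potential lerD2r exprS mulrA mulr_suml.
  rewrite -!mulr_suml le_eqVlt; apply/orP; left; apply/eqP; congr (_ * _).
  by rewrite mulr_suml; apply: eq_bigr => x _; rewrite /factor subsetT mul1r.
Qed.

Lemma packing_tape L :
  expose q (layers L K) miss <=
  n%:R ^+ k * lam ^- L * (1 + edge_rate n) ^+ N + beta * (N%:R * eta).
Proof.
have N0 : (0 + 0 + N)%N = N by [].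
apply: le_trans (round_boundP (layers L K) N0 (packs_nil k n)) _.
rewrite /round_potential add0r.
rewrite lerD2r ler_wpM2r ?(le_trans ler01) ?round_factor_ge1 //.
rewrite (eq_bigr (fun=> lam ^- L)) => [|x xK]; last by rewrite /weight count_layers xK muln1.
by rewrite sumr_const card_complete_kpartite -[leLHS]mulr_natl natrX.
Qed.

End Process.

(** * From coins to random hypergraphs *)

Section Density.
Variables (R : realFieldType) (T : finType).
Implicit Types (p q : R) (B : {set T}) (G : {set T} -> R).

Lemma bernoulli_ineq q L : 0 <= q <= 1 -> 1 - L%:R * q <= (1 - q) ^+ L.
Proof.
case/andP=> q0 q1; elim: L => [|L IH]; first by rewrite mul0r subr0.
rewrite exprS; apply: le_trans (ler_wpM2l _ IH); last by rewrite subr_ge0.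
rewrite -subr_ge0 -[L.+1%:R]natr1.
rewrite (_ : _ - _ = L%:R * q ^+ 2); last by ring.
by rewrite mulr_ge0 ?ler0n ?exprn_ge0.
Qed.

Lemma expose_nseq q L x (F : seq T -> R) h : (forall j, F (nseq j.+1 x) = h) ->
  expose q (nseq L x) F = (1 - (1 - q) ^+ L) * h + (1 - q) ^+ L * F [::].
Proof.
elim: L F => [|L IH] F Fh /=; first by rewrite expr0; ring.
rewrite (IH F Fh) (IH (fun s => F (x :: s))); last by move=> j; apply: Fh j.+1.
by rewrite (Fh 0%N) exprS; ring.
Qed.

(** At least one of [L] coins succeeds with probability 1 - (1 - q)^L <= L q <= p, so edges of
    density [p] dominate the coins, and [G] is decreasing. *)
Lemma expose_density q p L s G : 0 <= q <= 1 -> 0 <= p <= 1 -> L%:R * q <= p ->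
  (forall W W' : {set T}, W \subset W' -> G W' <= G W) ->
  expose p s (fun s => G [set x in s]) <=
  expose q (flatten [seq nseq L x | x <- s]) (fun s => G [set x in s]).
Proof.
move=> q01 p01 Lqp; elim: s G => [|x s IH] G Ganti //=.
rewrite expose_cat.
pose h1 := expose q (flatten [seq nseq L x | x <- s]) (fun s => G (x |: [set x in s])).
pose h0 := expose q (flatten [seq nseq L x | x <- s]) (fun s => G [set x in s]).
rewrite (@expose_nseq _ _ _ _ h1) /=; last first.
  move=> j; apply: eq_expose => s'; congr G; apply/setP => y.
  by rewrite in_setU1 !inE mem_cat mem_nseq; case: (y == x); rewrite ?andbF.
rewrite -/h0.
have h10 : h1 <= h0 by apply: ler_expose => // s'; apply: Ganti; apply: subsetUr.
have IH1 : expose p s (fun s => G [set y in x :: s]) <= h1.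
  have := IH (fun W => G (x |: W)); rewrite -/h1 => IHx.
  rewrite (@eq_expose _ _ _ _ _ (fun s => G (x |: [set x in s]))).
    by apply: IHx => W W' WW'; apply: Ganti; apply: setUS.
  by move=> s'; rewrite set_cons.
have IH0 : expose p s (fun s => G [set x in s]) <= h0 by apply: IH.
have [p0 p1] := andP p01.
have cp : 1 - p <= (1 - q) ^+ L.
  by apply: le_trans (bernoulli_ineq L q01); rewrite lerD2l lerN2.
set c := (1 - q) ^+ L in cp *.
apply: le_trans (lerD (ler_wpM2l p0 IH1) (ler_wpM2l _ IH0)) _; first by rewrite subr_ge0.
rewrite -subr_ge0 (_ : _ - _ = (c - (1 - p)) * (h0 - h1)); last by ring.
by rewrite mulr_ge0 ?subr_ge0.
Qed.

Lemma setprob_layers q p L B G : 0 <= q <= 1 -> 0 <= p <= 1 -> L%:R * q <= p ->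
  (forall W W' : {set T}, W \subset W' -> G W' <= G W) ->
  setprob p B G <= expose q (layers L B) (fun s => G [set x in s]).
Proof.
move=> q01 p01 Lqp Ganti; rewrite -expose_enum.
have Gperm : perm_inv (fun s => G [set x in s]).
  by move=> s s' ss'; congr G; apply/setP => x; rewrite !inE (perm_mem ss').
rewrite (expose_perm q Gperm (_ : perm_eq (layers L B) (flatten [seq nseq L x | x <- enum B]))).
  exact: expose_density.
apply/allP => x _ /=; rewrite count_layers -(mem_enum B) -(count_uniq_mem x (enum_uniq B)).
elim: (enum B) => [|y s IH] /=; first by rewrite muln0.
by rewrite count_cat count_nseq mulnDr (eqP IH) mulnC.
Qed.

End Density.

Section Finite.
Variables (R : realFieldType) (k n : nat).
Local Notation T := {set vertex k n}.
Local Notation K := (complete_kpartite k n).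

Definition packing_number_ge (a : R) (H : {set T}) : bool :=
  [exists F : {set {set T}}, disjoint_perfect_matchings H F && (a <= #|F|%:R)].

Lemma packing_number_geS a (H H' : {set T}) : H \subset H' ->
  packing_number_ge a H -> packing_number_ge a H'.
Proof.
move=> HH' /existsP[F /andP[FH aF]]; apply/existsP; exists F.
by rewrite aF (disjoint_perfect_matchingsS HH' FH).
Qed.

Variables (m f N d L : nat) (q p lam c E a : R).
Hypotheses (k0 : (0 < k)%N) (m0 : (0 < m)%N) (mn : (m <= n)%N) (mf : (m < 2 ^ f)%N).
Hypotheses (q0 : 0 < q) (q1 : q <= 1) (p01 : 0 <= p <= 1) (Lqp : L%:R * q <= p).
Hypotheses (lam1 : 1 <= lam) (c0 : 0 <= c).
Hypothesis E_bound : forall b : nat, b.+1%:R ^+ b <= E * b%:R ^+ b.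
Hypothesis qE : 4 <= q * (m%:R / E) ^+ k.-1.
Hypothesis step_rate : forall b, (m <= b <= n)%N ->
  (lam - 1) * (1 + edge_rate k m f q lam c b) <= c.
Hypothesis aN : a <= (N - d - d)%:R.

(** The first two terms are the initial potential with [beta] = 1 / (d + 1); the third is Markov's
    inequality for having more than [d] coincidences. Failed rounds and coincidences cost [d]
    matchings each, whence [N - d - d]. *)
Lemma packing_finite :
  setprob p K (fun H => (~~ packing_number_ge a H)%:R) <=
  n%:R ^+ k * lam ^- L * (1 + edge_rate k m f q lam c n) ^+ N +
  d.+1%:R^-1 * (N%:R * (f%:R * (4 / (q * (m%:R / E) ^+ k.-1)))) +
  d.+1%:R^-1 * (q ^+ 2 * (n ^ k * 'C(L, 2))%:R).
Proof.
have q01 : 0 <= q <= 1 by rewrite ltW.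
have d0 : 0 < d.+1%:R :> R by rewrite ltr0n.
pose eta := f%:R * (4 / (q * (m%:R / E) ^+ k.-1)).
have eta0 : 0 <= eta.
  by rewrite mulr_ge0 ?ler0n ?divr_ge0 ?(le_trans _ qE) ?ler0n.
have tape := @packing_tape R k n m f N d q lam c eta d.+1%:R^-1 k0 m0 mn q0 q1 lam1 c0.
have {tape} tape : expose q (layers L K) (miss R N d) <=
    n%:R ^+ k * lam ^- L * (1 + edge_rate k m f q lam c n) ^+ N + d.+1%:R^-1 * (N%:R * eta).
  apply: tape => //; first by rewrite invr_ge0 ltW.
    by rewrite mulVf ?gt_eqF.
  by move=> A bA; apply: leftover_matching.
apply: le_trans (setprob_layers (L := L) K q01 p01 Lqp _) _.
  move=> W W' WW'; rewrite ler_nat; case: (boolP (packing_number_ge a W)) => //.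
    by move=> /(packing_number_geS WW') ->.
  by move=> _; case: packing_number_ge.
apply: (@le_trans _ _ (expose q (layers L K)
    (fun s => miss R N d s + d.+1%:R^-1 * (coincidences s)%:R))).
  apply: ler_expose => // s; rewrite /miss.
  have [/existsP[F /andP[FF NF]]|_] := boolP (packs (N - d) s); last first.
    apply: (@le_trans _ _ 1); first by case: packing_number_ge; rewrite ?ler01.
    by rewrite lerDl mulr_ge0 ?invr_ge0 ?ler0n.
  rewrite add0r; case: (leqP (coincidences s) d) => [sd|ds].
    rewrite (_ : packing_number_ge _ _); first by rewrite mulr_ge0 ?invr_ge0 ?ler0n.
    apply/existsP; exists F; rewrite FF (le_trans aN) // ler_nat leq_subLR (leq_trans NF) //.
    by rewrite [(d + _)%N]addnC leq_add2l.
  apply: (@le_trans _ _ 1); first by case: packing_number_ge; rewrite ?ler01.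
  by rewrite mulrC ler_pdivlMr // mul1r ler_nat.
rewrite exposeD exposeZ expose_coincidences coincidences_layers.
by rewrite card_complete_kpartite lerD2r.
Qed.

End Finite.

Lemma Pr_kpartiteE (R : realType) (k n : nat) (p : R) (P : pred {set {set vertex k n}}) :
  Pr_kpartite p P = 1 - setprob p (complete_kpartite k n) (fun H => (~~ P H)%:R).
Proof.
rewrite -{1}(@setprob_const R _ p (complete_kpartite k n) 1) -sumrB /Pr_kpartite big_mkcondr /=.
apply: eq_bigr => H _; case: (P H); first by rewrite mulr0 mulr1 subr0.
by rewrite subrr.
Qed.

(** * Random colourings *)

Section Colour.
Variables (R : realFieldType) (T : finType) (s : nat).
Implicit Types (p : R) (t : seq T) (h : seq (T * 'I_s)).

(** Each element is absent or gets one of [s] colours, each with probability [p]: the union has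
    density s p and every colour class has density p. *)
Fixpoint colour p t (G : seq (T * 'I_s) -> R) : R :=
  if t is x :: t' then
    \sum_i p * colour p t' (fun h => G ((x, i) :: h)) + (1 - s%:R * p) * colour p t' G
  else G [::].

Definition colour_class h i : seq T := [seq e.1 | e <- h & e.2 == i].

Lemma ler_colour p t G G' : 0 <= p -> s%:R * p <= 1 ->
  (forall h, subseq [seq e.1 | e <- h] t -> G h <= G' h) ->
  colour p t G <= colour p t G'.
Proof.
move=> p0 sp1; elim: t G G' => [|x t IH] G G' leG /=; first exact: leG.
apply: lerD; last first.
  rewrite ler_wpM2l ?subr_ge0 //; apply: IH => h ht; apply: leG.
  by apply: subseq_trans ht _; apply: subseq_cons.
apply: ler_sum => i _; rewrite ler_wpM2l //; apply: IH => h ht; apply: leG.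
by rewrite /= eqxx.
Qed.

Lemma colour_edges p t (G : seq T -> R) :
  colour p t (fun h => G [seq e.1 | e <- h]) = expose (s%:R * p) t G.
Proof.
elim: t G => //= x t IH G; rewrite IH; congr (_ + _).
rewrite -(IH (fun u => G (x :: u))) /= sumr_const card_ord.
by rewrite -[RHS]mulrA mulr_natl.
Qed.

Lemma colour_class_expose p t (G : seq T -> R) i :
  colour p t (fun h => G (colour_class h i)) = expose p t G.
Proof.
elim: t G => //= x t IH G; rewrite IH (bigD1 i) //= /colour_class /= eqxx.
rewrite -(IH (fun u => G (x :: u))) (eq_bigr (fun=> p * expose p t G)) => [|j /negPf ji].
  rewrite sumr_const cardC1 card_ord -[_ *+ s.-1]mulr_natr -subn1 natrB ?(leq_ltn_trans _ (ltn_ord i)) //.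
  by ring.
by rewrite -(IH G) /= ji.
Qed.

Lemma colourZ p t (a : R) G : colour p t (fun h => a * G h) = a * colour p t G.
Proof.
elim: t G => //= x t IH G; rewrite IH mulrDr mulr_sumr; congr (_ + _); last by ring.
by apply: eq_bigr => i _; rewrite IH; ring.
Qed.

Lemma colour_sum (I : finType) p t (G : I -> seq (T * 'I_s) -> R) :
  colour p t (fun h => \sum_i G i h) = \sum_i colour p t (G i).
Proof.
elim: t G => //= x t IH G; rewrite IH [RHS]big_split /= mulr_sumr; congr (_ + _).
rewrite exchange_big /=; apply: eq_bigr => i _.
by rewrite (IH (fun j h => G j ((x, i) :: h))) mulr_sumr.
Qed.

End Colour.

Section Split.
Variables (R : realFieldType) (k n : nat).
Hypotheses (k0 : (0 < k)%N) (n0 : (0 < n)%N).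
Local Notation T := {set vertex k n}.
Local Notation K := (complete_kpartite k n).

Lemma packing_number_geU (a b : R) (H H' : {set T}) : [disjoint H & H'] ->
  packing_number_ge a H -> packing_number_ge b H' ->
  packing_number_ge (a + b) (H :|: H').
Proof.
move=> dH /existsP[F /andP[FH aF]] /existsP[F' /andP[F'H' bF']].
case/andP: FH => /forall_inP FH tF; case/andP: F'H' => /forall_inP F'H' tF'.
have dF M M' : M \in F -> M' \in F' -> [disjoint M & M'].
  move=> /FH/and3P[MH _ _] /F'H'/and3P[MH' _ _].
  exact: disjointW dH.
apply/existsP; exists (F :|: F'); apply/andP; split.
  apply/andP; split.
    apply/forall_inP => M; rewrite inE => /orP[/FH|/F'H'] /and3P[MH tM cM].
      by rewrite /perfect_matching tM cM (subset_trans MH) ?subsetUl.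
    by rewrite /perfect_matching tM cM (subset_trans MH) ?subsetUr.
  apply/trivIsetP => M M'; rewrite !inE => /orP[MF|MF] /orP[M'F|M'F] nM.
  - exact: (trivIsetP tF).
  - exact: dF.
  - by rewrite disjoint_sym dF.
  - exact: (trivIsetP tF').
rewrite cardsU (_ : F :&: F' = set0) ?cards0 ?subn0 ?natrD ?lerD //.
apply/setP => M; rewrite !inE; apply/negP => /andP[MF MF'].
(* A common member would be disjoint from itself, hence empty, yet it covers a nonempty vertex
   set. *)
have := dF _ _ MF MF'; rewrite -setI_eq0 setIid => /eqP M0.
have /and3P[_ _] := FH _ MF; rewrite M0 /cover big_set0 => /eqP/setP/(_ (Ordinal k0, Ordinal n0)).
by rewrite !inE.
Qed.

Lemma packing_colours s (h : seq (T * 'I_s)) (a : R) (cs : seq 'I_s) :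
  uniq [seq e.1 | e <- h] -> uniq cs ->
  packing_number_ge
    (a * (count (fun i => packing_number_ge a [set x in colour_class h i]) cs)%:R)
    [set x in [seq e.1 | e <- h & e.2 \in cs]].
Proof.
move=> uh; elim: cs => [_|i cs IH /= /andP[ics ucs]].
  rewrite mulr0; apply/existsP; exists set0.
  rewrite /disjoint_perfect_matchings cards0 lexx andbT; apply/andP; split.
    by apply/forall_inP => M; rewrite inE.
  by apply/trivIsetP => ? ?; rewrite inE.
rewrite (_ : [set x in [seq e.1 | e <- h & e.2 \in i :: cs]] =
    [set x in colour_class h i] :|: [set x in [seq e.1 | e <- h & e.2 \in cs]]).
  case: (boolP (packing_number_ge a [set x in colour_class h i])) => [good|_]; last first.
    by rewrite /= add0n; apply: packing_number_geS (IH ucs); apply: subsetUr.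
  rewrite /= natrD mulrDr mulr1; apply: packing_number_geU good (IH ucs).
  apply/pred0P => x; rewrite /= !inE; apply/negP.
  case/andP=> /mapP[e] + xe /mapP[e'] + xe'.
  rewrite !mem_filter => /andP[/eqP ei eh] /andP[e'cs e'h].
  have ee' : e = e'.
    have fst_inj : {in h &, injective fst}.
      move=> u v uh' vh uv; apply/eqP; rewrite -(nth_index u uh') -(nth_index u vh).
      rewrite nth_uniq ?index_mem //; last by move: uh; apply: map_uniq.
      rewrite -(nth_uniq u.1 _ _ uh) ?size_map ?index_mem //.
      by rewrite !(nth_map u) ?index_mem // !nth_index // uv.
    by apply: fst_inj; rewrite // -xe -xe'.
  by rewrite -ee' ei (negPf ics) in e'cs.
apply/setP => x; rewrite !inE; apply/mapP/orP => [[e]|].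
  rewrite mem_filter inE => /andP[/orP[ei|ecs] eh] ->; [left|right].
    by apply/mapP; exists e => //; rewrite mem_filter ei.
  by apply/mapP; exists e => //; rewrite mem_filter ecs.
by case=> /mapP[e]; rewrite mem_filter => /andP[ee eh] ->; exists e => //;
  rewrite mem_filter inE ee ?orbT eh.
Qed.

(** By linearity the expected number of bad colours is at most s eta, so Markov's inequality bounds
    the probability of delta s bad ones by eta / delta. The packings of the good colours are
    edge-disjoint and add up. *)
Lemma setprob_colours s (p a eta delta : R) : (0 < s)%N ->
  0 <= p -> s%:R * p <= 1 -> 0 <= a -> 0 < delta ->
  setprob p K (fun H => (~~ packing_number_ge a H)%:R) <= eta ->
  setprob (s%:R * p) K
    (fun H => (~~ packing_number_ge ((1 - delta) * (s%:R * a)) H)%:R) <= eta / delta.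
Proof.
move=> s0 p0 sp1 a0 delta0 le_eta.
have sR : 0 < s%:R :> R by rewrite ltr0n.
have ds0 : 0 < delta * s%:R by rewrite mulr_gt0.
rewrite -expose_enum -colour_edges.
pose bad (h : seq (T * 'I_s)) (i : 'I_s) : R := (~~ packing_number_ge a [set x in colour_class h i])%:R.
apply: (@le_trans _ _ (colour p (enum K) (fun h => (delta * s%:R)^-1 * \sum_i bad h i))).
  apply: ler_colour => // h /subseq_uniq -/(_ (enum_uniq _)) uh.
  have [_|miss] := boolP (packing_number_ge _ _).
    by rewrite mulr_ge0 ?invr_ge0 ?(ltW ds0) // sumr_ge0.
  rewrite mulrC ler_pdivlMr // mul1r leNgt; apply: contraNN miss => few.
  have := packing_colours a uh (enum_uniq 'I_s).
  rewrite (_ : [seq e <- h | _] = h); last by apply/all_filterP/allP => e _; rewrite mem_enum.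
  case/existsP=> F /andP[FH aF]; apply/existsP; exists F; rewrite FH /=.
  apply: le_trans aF; rewrite mulrA [leRHS]mulrC ler_wpM2r //.
  have : \sum_i bad h i + (count (fun i => packing_number_ge a [set x in colour_class h i]) (enum 'I_s))%:R = s%:R.
    rewrite -sum1_count natr_sum [X in _ + X]big_mkcond big_enum -big_split /=.
    rewrite (eq_bigr (fun=> 1)); first by rewrite sumr_const card_ord.
    by move=> i _; rewrite /bad; case: packing_number_ge; rewrite ?addr0 ?add0r.
  move: (count _ _)%:R few => c; move: (\sum_i _) => b few bc; lra.
rewrite colourZ colour_sum (eq_bigr (fun=> setprob p K (fun H => (~~ packing_number_ge a H)%:R))).
  rewrite sumr_const card_ord -[_ *+ s]mulr_natl invfM.
  rewrite (_ : _ * _ = setprob p K (fun H => (~~ packing_number_ge a H)%:R) / delta).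
    by rewrite ler_wpM2r // invr_ge0 ltW.
  by field; rewrite !gt_eqF.
move=> i _; rewrite -(expose_enum p K (fun H => (~~ packing_number_ge a H)%:R)).
exact: (colour_class_expose p (enum K) (fun s => (~~ packing_number_ge a [set x in s])%:R)).
Qed.

End Split.

From mathcomp Require Import all_classical all_reals all_analysis.

Import numFieldNormedType.Exports.

Local Open Scope classical_set_scope.
Local Open Scope ring_scope.

(** * Estimates *)

Section Estimates.
Variable R : realType.
Implicit Types (x y l eps q p : R).

(** Use e^y (1 - y) <= 1 and (1 + y + 2 y^2)(1 - y) = 1 + y^2 (1 - 2 y). *)
Lemma expR_le_quadratic y : 0 <= y <= 2^-1 -> expR y <= 1 + y + 2 * y ^+ 2.
Proof.
move=> /andP[y0 y1]; have y2 : 0 < 1 - y by lra.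
have h : expR y * (1 - y) <= 1.
  rewrite -[leRHS](expRxMexpNx_1 y) ler_wpM2l ?expR_ge0 //.
  exact: expR_ge1Dx.
rewrite -(ler_pM2r y2); apply: le_trans h _.
rewrite -subr_ge0 (_ : _ - _ = y ^+ 2 * (1 - 2 * y)); last by ring.
by rewrite mulr_ge0 ?exprn_ge0 //; lra.
Qed.

Lemma expR1_bound (b : nat) : b.+1%:R ^+ b <= expR 1 * b%:R ^+ b :> R.
Proof.
case: b => [|b]; first by rewrite !expr0 mulr1 (le_trans _ (expR_ge1Dx _)) // lerDl.
have b0 : 0 < b.+1%:R :> R by rewrite ltr0n.
have -> : expR 1 = expR (b.+1%:R^-1) ^+ b.+1 :> R.
  by rewrite -expRM_natr mulVf ?gt_eqF.
rewrite -exprMn lerXn2r ?nnegrE ?mulr_ge0 ?expR_ge0 ?ler0n //.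
rewrite -ler_pdivrMr // -[b.+2%:R]natr1 mulrDl divff ?gt_eqF // mul1r.
exact: expR_ge1Dx.
Qed.

Lemma expR1_ge1 : 1 <= expR 1 :> R.
Proof. by apply: le_trans (expR_ge1Dx _); rewrite lerDl. Qed.

(** Rests on e^(1/2) <= 2, the quadratic bound at 1/2. *)
Lemma trunc_log_bound l (n : nat) : (0 < n)%N -> n%:R = expR l ->
  (trunc_log 2 n)%:R <= 2 * l.
Proof.
move=> n0 nl; have := trunc_logP (ltnSn 1) n0.
rewrite -(ler_nat R) nl natrX => h.
have h2 : expR ((trunc_log 2 n)%:R / 2) <= expR l.
  apply: le_trans h; rewrite expRM_natl lerXn2r ?nnegrE ?expR_ge0 //.
  by apply: le_trans (expR_le_quadratic _) _; lra.
by rewrite ler_expR in h2; lra.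
Qed.

Section Rates.
Variables (a f m b : nat) (q eps : R).
Hypotheses (f0 : (0 < f)%N) (m0 : (0 < m)%N) (mb : (m <= b)%N).
Hypotheses (eps0 : 0 < eps) (eps1 : 20 * eps <= 1) (q0 : 0 < q).
(** With [lam = expR theta], the final [f] coins cost only a factor e^eps. The excess 4 eps in [c]
    absorbs the edge rate and the second-order part of [lam]. *)
Let theta := eps / f%:R.
Let c := theta * (1 + 4 * eps).
Let rate := edge_rate a.+1 m f q (expR theta) c b.

Let f1 : 1 <= f%:R :> R. Proof. by rewrite ler1n. Qed.
Let fgt0 : 0 < f%:R :> R. Proof. by rewrite ltr0n. Qed.
Let mgt0 : 0 < m%:R :> R. Proof. by rewrite ltr0n. Qed.
Let bgt0 : 0 < b%:R :> R. Proof. by rewrite ltr0n (leq_trans m0). Qed.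
Let mbR : m%:R <= b%:R :> R. Proof. by rewrite ler_nat. Qed.

Lemma theta_gt0 : 0 < theta. Proof. by rewrite divr_gt0. Qed.

Lemma theta_le : theta <= eps.
Proof. by rewrite ler_pdivrMr // ler_peMr // ltW. Qed.

Lemma c_ge0 : 0 <= c.
Proof. by rewrite mulr_ge0 ?(ltW theta_gt0) // addr_ge0 // mulr_ge0 // ltW. Qed.

Lemma expR_theta_f : expR theta ^+ f = expR eps.
Proof. by rewrite -expRM_natr divfK // gt_eqF. Qed.

Lemma expR_eps_le : expR eps - 1 <= 2 * eps.
Proof.
have e0 := eps0; have e1 := eps1; have h : expR eps <= 1 + eps + 2 * eps ^+ 2.
  by apply: expR_le_quadratic; rewrite (ltW eps0) /=; lra.
have : eps ^+ 2 <= eps * 20^-1 by rewrite expr2 ler_wpM2l ?(ltW eps0) //; lra.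
lra.
Qed.

Lemma rate_le : rate <= (expR eps - 1) * (m%:R / b%:R) ^+ a.+1 + c / (q * b%:R ^+ a).
Proof.
rewrite /rate /edge_rate /total_rate expR_theta_f mulrDl expr_div_n mulrA lerD2l.
rewrite invfM -[leLHS]mulrA [leRHS]mulrA ler_wpM2l ?divr_ge0 ?c_ge0 ?(ltW q0) //.
rewrite exprS invfM mulrA ler_piMl ?invr_ge0 ?exprn_ge0 ?(ltW bgt0) //.
by rewrite ler_pdivrMr // mul1r gerBl ltW.
Qed.

(** Here [lam - 1] is at most theta (1 + 2 eps) and the rate at most 5 eps / 4, and (1 + 2 eps)(1 +
    5 eps / 4) <= 1 + 4 eps. *)
Lemma step_rate_bound : 4 * f%:R / eps ^+ 2 <= q * m%:R ^+ a ->
  (expR theta - 1) * (1 + rate) <= c.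
Proof.
move=> qm; have e0 := eps0; have e1 := eps1; have t0 := theta_gt0; have te := theta_le; have c0 := c_ge0.
have lt : expR theta - 1 <= theta * (1 + 2 * eps).
  have : expR theta <= 1 + theta + 2 * theta ^+ 2.
    by apply: expR_le_quadratic; rewrite (ltW t0) /=; lra.
  have : theta ^+ 2 <= theta * eps by rewrite expr2 ler_wpM2l ?(ltW eps0) //; lra.
  lra.
have ee : expR eps - 1 <= eps + 2 * eps ^+ 2.
  have : expR eps <= 1 + eps + 2 * eps ^+ 2.
    by apply: expR_le_quadratic; rewrite (ltW eps0) /=; lra.
  lra.
have em0 : 0 <= expR eps - 1.
  by rewrite subr_ge0 (le_trans _ (expR_ge1Dx _)) // lerDl ltW.
have r1 : (expR eps - 1) * (m%:R / b%:R) ^+ a.+1 <= eps + 2 * eps ^+ 2.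
  apply: le_trans ee; rewrite ler_piMr // exprn_ile1 ?divr_ge0 ?ler0n //.
  by rewrite ler_pdivrMr // mul1r.
have e2 : 0 < eps ^+ 2 by rewrite exprn_gt0.
have qb : 4 / eps ^+ 2 <= q * b%:R ^+ a.
  apply: (@le_trans _ _ (q * m%:R ^+ a)).
    apply: le_trans qm; rewrite ler_wpM2r ?invr_ge0 ?(ltW e2) //; have := f1; lra.
  by rewrite ler_wpM2l ?(ltW q0) // lerXn2r ?nnegrE ?ler0n.
have qb0 : 0 < q * b%:R ^+ a by rewrite mulr_gt0 // exprn_gt0.
have r2 : c / (q * b%:R ^+ a) <= c * eps ^+ 2 / 4.
  rewrite ler_pdivrMr // (_ : _ / 4 * _ = c * (eps ^+ 2 / 4 * (q * b%:R ^+ a))); last by ring.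
  rewrite -[leLHS]mulr1; apply: ler_wpM2l => //.
  by move: qb; rewrite ler_pdivrMr //; lra.
have c2 : c <= 2 * eps.
  have : c <= eps * (1 + 4 * eps) by rewrite ler_wpM2r //; lra.
  by move=> /le_trans; apply; nra.
have e20 : eps ^+ 2 <= eps / 20 by rewrite expr2 ler_wpM2l ?(ltW eps0) //; lra.
have r3 : c * eps ^+ 2 / 4 <= eps ^+ 2 / 40 by nra.
have rr : rate <= 5 / 4 * eps by apply: le_trans rate_le _; lra.
apply: (@le_trans _ _ (theta * (1 + 2 * eps) * (1 + 5 / 4 * eps))).
  apply: (@le_trans _ _ ((expR theta - 1) * (1 + 5 / 4 * eps))).
    by rewrite ler_wpM2l ?lerD2l // subr_ge0 (le_trans _ (expR_ge1Dx _)) // lerDl ltW.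
  by rewrite ler_wpM2r //; lra.
by rewrite /c -mulrA ler_wpM2l ?(ltW t0) //; nra.
Qed.

End Rates.

End Estimates.

(** * Choice of parameters for small p *)

Section Sparse.
Variable R : realType.
Implicit Types (l eps q p n E f m : R) (a : nat).

(** At theta = eps / f per coin, the unspent fraction eps of the p / q coins of an edge must
    outweigh n^(a + 1). Of the exponent 4 (a + 1) of l, a share 3 a is lost to m >= n / (2 l^3). The
    remaining l^(a + 4) must beat a constant times l^3: one l is the target, and two come from [f],
    in theta and in [q]. *)
Lemma budget_bound a n l p q eps E f m : 0 < n -> 1 <= l -> 0 < eps -> 1 <= E ->
  0 < f -> f <= 3 * l -> 0 < q -> n / (2 * l ^+ 3) <= m ->
  q * m ^+ a = 4 * f * E ^+ a / eps ^+ 2 ->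
  l ^+ (4 * a.+1) / n ^+ a <= p ->
  72 * a.+3%:R * (2 * E) ^+ a / eps ^+ 4 <= l ->
  2 * a.+3%:R * l <= eps ^+ 2 * (p / q) / f.
Proof.
move=> n0 l1 e0 E1 f0 fl q0 nm qm lp Ll.
have l0 : 0 < l by apply: lt_le_trans l1.
have E0 : 0 < E by apply: lt_le_trans E1.
have m0 : 0 < m by apply: lt_le_trans nm; rewrite divr_gt0 // mulr_gt0 // exprn_gt0.
have pm : l ^+ (a + 4) / 2 ^+ a <= p * m ^+ a.
  apply: (@le_trans _ _ (l ^+ (4 * a.+1) / n ^+ a * (n / (2 * l ^+ 3)) ^+ a)).
    rewrite expr_div_n exprMn -exprM (_ : 4 * a.+1 = (a + 4) + 3 * a)%N; last by ring.
    rewrite [leRHS](_ : _ = l ^+ (a + 4) / 2 ^+ a) // [l ^+ (_ + 3 * a)]exprD.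
    have u0 : l ^+ (3 * a) != 0 by rewrite expf_neq0 // gt_eqF.
    have v0 : n ^+ a != 0 by rewrite expf_neq0 // gt_eqF.
    have w0 : 2 ^+ a != 0 :> R by rewrite expf_neq0.
    move: (l ^+ (3 * a)) (n ^+ a) (2 ^+ a : R) (l ^+ (a + 4)) u0 v0 w0 => u v w z u0 v0 w0.
    by field; rewrite u0 v0 w0.
  have nl0 : 0 <= n / (2 * l ^+ 3).
    by rewrite divr_ge0 ?(ltW n0) // mulr_ge0 // exprn_ge0 // ltW.
  apply: ler_pM => //.
  - by rewrite divr_ge0 ?exprn_ge0 ?(ltW l0) ?(ltW n0).
  - exact: exprn_ge0.
  - by rewrite lerXn2r ?nnegrE ?(ltW m0).
have f2 : f ^+ 2 <= 9 * l ^+ 2.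
  have -> : 9 * l ^+ 2 = (3 * l) ^+ 2 by ring.
  by rewrite lerXn2r ?nnegrE ?(ltW f0) ?mulr_ge0 ?(ltW l0).
have Ll' : 72 * a.+3%:R * (2 * E) ^+ a <= l * eps ^+ 4.
  by rewrite -ler_pdivrMr // exprn_gt0.
have ma0 : 0 < m ^+ a by rewrite exprn_gt0.
rewrite ler_pdivlMr // mulrA ler_pdivlMr // -(ler_pM2r ma0).
rewrite (_ : _ * m ^+ a = 2 * a.+3%:R * l * f * (q * m ^+ a)); last by ring.
have e2 : 0 < eps ^+ 2 by rewrite exprn_gt0.
rewrite qm -[leRHS]mulrA mulrA ler_pdivrMr //.
apply: (@le_trans _ _ (l ^+ (a + 4) / 2 ^+ a * eps ^+ 4)); last first.
  rewrite (_ : _ * eps ^+ 2 = p * m ^+ a * eps ^+ 4); last by ring.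
  by rewrite ler_wpM2r // exprn_ge0 // ltW.
rewrite [leRHS]mulrAC ler_pdivlMr ?exprn_gt0 //.
apply: (@le_trans _ _ (72 * a.+3%:R * (2 * E) ^+ a * l ^+ 3)).
  rewrite exprMn (_ : _ * 2 ^+ a = 8 * a.+3%:R * (2 ^+ a * E ^+ a) * l * f ^+ 2); last by ring.
  rewrite (_ : _ * l ^+ 3 = 8 * a.+3%:R * (2 ^+ a * E ^+ a) * l * (9 * l ^+ 2)); last by ring.
  by apply: ler_wpM2l => //; rewrite !mulr_ge0 ?ler0n ?exprn_ge0 ?(ltW E0) ?(ltW l0).
apply: (@le_trans _ _ (l * eps ^+ 4 * l ^+ 3)); first by rewrite ler_wpM2r // exprn_ge0 // ltW.
rewrite (_ : l * eps ^+ 4 * l ^+ 3 = l ^+ 4 * eps ^+ 4); last by ring.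
by rewrite ler_wpM2r ?exprn_ge0 ?(ltW e0) // ler_weXn2l // leq_addl.
Qed.

(** The drift part of the rate contributes theta (p / q)(1 + 4 eps) over p n^a rounds. The part for
    the final coins adds at most theta (p / q) eps, because m / n <= l^-3 while q m^a is of order l.
    Finally (1 - 6 eps)(1 + 5 eps) <= 1 - eps. *)
Lemma exponent_bound a (f m n N : nat) l p q eps E :
  (0 < f)%N -> (0 < m)%N -> (m <= n)%N -> 1 <= l -> 0 < eps -> 20 * eps <= 1 -> 1 <= E ->
  0 < q -> 0 <= p -> f%:R <= 3 * l -> m%:R <= n%:R / l ^+ 3 ->
  q * m%:R ^+ a = 4 * f%:R * E ^+ a / eps ^+ 2 ->
  N%:R <= (1 - 6 * eps) * (p * n%:R ^+ a) ->
  72 * a.+3%:R * (2 * E) ^+ a / eps ^+ 4 <= l ->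
  forall theta, theta = eps / f%:R ->
  N%:R * edge_rate a.+1 m f q (expR theta) (theta * (1 + 4 * eps)) n <=
  theta * (p / q) * (1 - eps).
Proof.
move=> f0 m0 mn l1 e0 e1 E1 q0 p0 fl ml qm NP Ll theta thE.
have l0 : 0 < l by apply: lt_le_trans l1.
have E0 : 0 < E by apply: lt_le_trans E1.
have fR : 0 < f%:R :> R by rewrite ltr0n.
have mR : 0 < m%:R :> R by rewrite ltr0n.
have nR : 0 < n%:R :> R by rewrite ltr0n (leq_trans m0).
have th0 : 0 < theta by rewrite thE divr_gt0.
set rate := edge_rate _ _ _ _ _ _ _.
have rle : rate <= 2 * eps * (m%:R / n%:R) ^+ a.+1 + theta * (1 + 4 * eps) / (q * n%:R ^+ a).
  rewrite /rate thE; apply: le_trans (rate_le a f0 m0 mn e0 q0) _; rewrite lerD2r ler_wpM2r //.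
  exact: expR_eps_le.
set X := p / q; have X0 : 0 <= X by rewrite divr_ge0 // ltW.
have pX : p = X * q by rewrite /X divfK // gt_eqF.
have key : p * n%:R ^+ a * rate <= theta * X * (1 + 5 * eps).
  have pn0 : 0 <= p * n%:R ^+ a by rewrite mulr_ge0 // exprn_ge0 // ltW.
  apply: le_trans (ler_wpM2l pn0 rle) _.
  have -> : p * n%:R ^+ a * (2 * eps * (m%:R / n%:R) ^+ a.+1 +
      theta * (1 + 4 * eps) / (q * n%:R ^+ a)) =
      X * (2 * eps * (q * m%:R ^+ a) * (m%:R / n%:R)) + theta * X * (1 + 4 * eps).
    have na0 : n%:R ^+ a != 0 :> R by rewrite expf_neq0 // gt_eqF.
    rewrite pX exprS expr_div_n; move: (n%:R ^+ a : R) na0 => na na0.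
    by field; rewrite na0 !gt_eqF.
  have -> : theta * X * (1 + 5 * eps) = X * (theta * eps) + theta * X * (1 + 4 * eps) by ring.
  rewrite lerD2r ler_wpM2l // qm.
  have mn3 : m%:R / n%:R <= (l ^+ 3)^-1.
    by rewrite ler_pdivrMr // mulrC.
  have e4 : 0 < eps ^+ 4 by rewrite exprn_gt0.
  have e2 : 0 < eps ^+ 2 by rewrite exprn_gt0.
  have l3 : 0 < l ^+ 3 by rewrite exprn_gt0.
  apply: (@le_trans _ _ (2 * eps * (4 * f%:R * E ^+ a / eps ^+ 2) * (l ^+ 3)^-1)).
    by rewrite ler_wpM2l // !mulr_ge0 ?invr_ge0 ?exprn_ge0 ?(ltW e0) ?(ltW E0) ?(ltW fR).
  rewrite ler_pdivrMr // thE.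
  have f2 : f%:R ^+ 2 <= 9 * l ^+ 2.
    have -> : 9 * l ^+ 2 = (3 * l) ^+ 2 by ring.
    by rewrite lerXn2r ?nnegrE ?(ltW fR) ?mulr_ge0 ?(ltW l0).
  have big : 72 * E ^+ a <= l * eps ^+ 3.
    have Ea : 0 <= E ^+ a by rewrite exprn_ge0 // ltW.
    have : 72 * a.+3%:R * (2 * E) ^+ a <= l * eps ^+ 4 by rewrite -ler_pdivrMr.
    have : 72 * E ^+ a <= 72 * a.+3%:R * (2 * E) ^+ a.
      rewrite exprMn -[leLHS]mulr1 -!mulrA ler_wpM2l //.
      rewrite mulrA [leRHS]mulrC ler_wpM2l // mulr_ege1 ?exprn_ege1 ?ler1n //.
    have : l * eps ^+ 4 <= l * eps ^+ 3.
      rewrite ler_wpM2l ?(ltW l0) // exprS ler_piMl ?exprn_ge0 ?(ltW e0) //; lra.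
    lra.
  rewrite -(ler_pM2r fR) -(ler_pM2r e0).
  have -> : 2 * eps * (4 * f%:R * E ^+ a / eps ^+ 2) * f%:R * eps = 8 * E ^+ a * f%:R ^+ 2.
    by field; rewrite gt_eqF.
  have -> : eps / f%:R * eps * l ^+ 3 * f%:R * eps = eps ^+ 3 * l ^+ 3.
    by field; rewrite gt_eqF.
  apply: (@le_trans _ _ (8 * E ^+ a * (9 * l ^+ 2))).
    by rewrite ler_wpM2l // mulr_ge0 // exprn_ge0 // ltW.
  rewrite (_ : 8 * E ^+ a * (9 * l ^+ 2) = 72 * E ^+ a * l ^+ 2); last by ring.
  rewrite (_ : eps ^+ 3 * l ^+ 3 = l * eps ^+ 3 * l ^+ 2); last by ring.
  by rewrite ler_wpM2r // exprn_ge0 // ltW.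
have rate0 : 0 <= rate.
  apply: edge_rate_ge0 => //; last by rewrite mulr_ge0 ?(ltW th0) //; lra.
  by apply: le_trans (expR_ge1Dx _); rewrite lerDl ltW.
apply: le_trans (ler_wpM2r rate0 NP) _; rewrite -[leLHS]mulrA.
have e6 : 0 <= 1 - 6 * eps by lra.
apply: le_trans (ler_wpM2l e6 key) _.
rewrite -subr_ge0 (_ : _ - _ = theta * X * (30 * eps ^+ 2)); last by ring.
have e30 : 0 <= 30 * eps ^+ 2 by rewrite mulr_ge0 // exprn_ge0 // ltW.
by rewrite mulr_ge0 // mulr_ge0 // ltW.
Qed.

End Sparse.

Lemma packing_sparse (R : realType) (a n : nat) (eps l p : R) :
  0 < eps -> 20 * eps <= 1 -> n%:R = expR l -> 2 * l ^+ 3 <= n%:R ->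
  72 * a.+3%:R * (2 * expR 1) ^+ a / eps ^+ 4 <= l ->
  l ^+ (4 * a.+1) / n%:R ^+ a <= p -> p <= eps ^+ 2 / n%:R -> p <= 1 ->
  setprob p (complete_kpartite a.+1 n)
    (fun H => (~~ packing_number_ge ((1 - 9 * eps) * (p * n%:R ^+ a)) H)%:R) <= 3 * eps.
Proof.
move=> e0 e1 nl ln3 Ll lp pn p1.
set E := expR 1 in Ll *.
have E1 : 1 <= E := expR1_ge1 R; have E0 : 0 < E by apply: expR_gt0.
have e2 : 0 < eps ^+ 2 by rewrite exprn_gt0.
have nR : 0 < n%:R :> R by rewrite nl expR_gt0.
have n0 : (0 < n)%N by rewrite -(ltr_nat R).
have le1 : 1 <= l * eps.
  have : 72 * a.+3%:R * (2 * E) ^+ a <= l * eps ^+ 4 by rewrite -ler_pdivrMr ?exprn_gt0.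
  have l0 : 0 <= l.
    apply: le_trans Ll; rewrite divr_ge0 ?exprn_ge0 ?(ltW e0) //.
    by rewrite !mulr_ge0 ?ler0n ?exprn_ge0 ?mulr_ge0 ?(ltW E0).
  have : l * eps ^+ 4 <= l * eps.
    rewrite ler_wpM2l // exprS ler_piMr ?(ltW e0) // exprn_ile1 ?(ltW e0) //; lra.
  have : 1 <= 72 * a.+3%:R * (2 * E) ^+ a.
    by rewrite !mulr_ege1 ?ler1n // exprn_ege1 // mulr_ege1 ?ler1n.
  lra.
have l1 : 1 <= l.
  have l0 : 0 <= l by rewrite -(pmulr_lge0 _ e0); lra.
  apply: le_trans le1 _; rewrite ler_piMr //; lra.
have l0 : 0 < l by apply: lt_le_trans l1.
have l3 : 0 < l ^+ 3 by rewrite exprn_gt0.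
pose m := Num.truncn (n%:R / l ^+ 3).
have nl2 : 2 <= n%:R / l ^+ 3 by rewrite ler_pdivlMr.
have nl0 : 0 <= n%:R / l ^+ 3 by lra.
have /andP[ml ml'] := truncn_itv nl0.
have m0 : (0 < m)%N by rewrite truncn_gt0; lra.
have mR : 0 < m%:R :> R by rewrite ltr0n.
have mn : (m <= n)%N.
  rewrite -(ler_nat R); apply: le_trans ml _.
  by rewrite ler_pdivrMr // ler_peMr ?ler0n // exprn_ege1.
have nm : n%:R / (2 * l ^+ 3) <= m%:R.
  have m1 : 1 <= m%:R :> R by rewrite ler1n.
  rewrite invfM mulrCA mulrC ler_pdivrMr //.
  by apply: le_trans (ltW ml') _; rewrite -/m -natr1; lra.
pose f := (trunc_log 2 n).+1.
have mf : (m < 2 ^ f)%N by apply: leq_ltn_trans mn _; apply: trunc_log_ltn.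
have fl : f%:R <= 3 * l.
  by have := trunc_log_bound n0 nl; rewrite /f -natr1; lra.
have f0 : (0 < f)%N by [].
have fR : 0 < f%:R :> R by rewrite ltr0n.
have f1 : 1 <= f%:R :> R by rewrite ler1n.
(* Chosen so that the failure bound f * 4 / (q (m/E)^a) of a completion is exactly eps^2. *)
pose q := 4 * f%:R * E ^+ a / eps ^+ 2 / m%:R ^+ a.
have ma0 : 0 < m%:R ^+ a :> R by rewrite exprn_gt0.
have Ea0 : 0 < E ^+ a by rewrite exprn_gt0.
have qm : q * m%:R ^+ a = 4 * f%:R * E ^+ a / eps ^+ 2 by rewrite divfK // gt_eqF.
have q0 : 0 < q by rewrite !divr_gt0 // !mulr_gt0.
clearbody q.
have qE : q * (m%:R / E) ^+ a = 4 * f%:R / eps ^+ 2.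
  by rewrite expr_div_n mulrA qm mulrAC mulfK ?gt_eqF.
have bb := budget_bound nR l1 e0 E1 fR fl q0 nm qm lp Ll.
set X := p / q in bb.
have a3 : 1 <= a.+3%:R :> R by rewrite ler1n.
have al : l <= a.+3%:R * l by rewrite ler_peMl // ltW.
have X1 : 1 <= X.
  have h : eps ^+ 2 * X / f%:R * f%:R = eps ^+ 2 * X by rewrite divfK // gt_eqF.
  have : 1 * 1 <= eps ^+ 2 * X / f%:R * f%:R by apply: ler_pM => //; lra.
  rewrite h mulr1 => h1; apply: le_trans h1 _; rewrite ler_piMl //.
    rewrite -(pmulr_rge0 _ e2); apply: le_trans (_ : 1 <= _) => //.
    by rewrite -h -[leLHS]mulr1; apply: ler_pM => //; lra.
  by rewrite exprn_ile1 ?(ltW e0) //; lra.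
have X0 : 0 <= X by apply: le_trans X1.
have p0 : 0 < p.
  by have := lt_le_trans ltr01 X1; rewrite pmulr_lgt0 ?invr_gt0.
have q1 : q <= 1 by apply: le_trans p1; rewrite -[leLHS]mul1r -ler_pdivlMr.
pose L := Num.truncn X; have /andP[LX XL] := truncn_itv X0; rewrite -/L in LX XL.
have Lq : L%:R * q <= p by rewrite -ler_pdivlMr.
pose P := p * n%:R ^+ a; rewrite -/P.
have P0 : 0 <= P by rewrite mulr_ge0 ?exprn_ge0 ?ler0n ?(ltW p0).
have lP : l <= P.
  apply: (@le_trans _ _ (l ^+ (4 * a.+1))); last by rewrite -ler_pdivrMr // exprn_gt0.
  by rewrite -{1}[l]expr1 ler_weXn2l.
have eP : 1 <= eps * P by apply: le_trans le1 _; rewrite mulrC ler_wpM2l // ltW.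
have P6 : 0 <= (1 - 6 * eps) * P by rewrite mulr_ge0 //; lra.
pose N := Num.truncn ((1 - 6 * eps) * P).
have /andP[NP PN] := truncn_itv P6; rewrite -/N in NP PN.
pose d := Num.truncn (eps * P).
have eP0 : 0 <= eps * P by lra.
have /andP[dP Pd] := truncn_itv eP0; rewrite -/d in dP Pd.
(* The loss 9 eps consists of 6 eps from [N], eps from each [d], and at most eps from rounding, as
   eps P >= 1. *)
have aN : (1 - 9 * eps) * P <= (N - d - d)%:R.
  have : N%:R <= (N - d - d)%:R + (d%:R + d%:R) :> R.
    by rewrite -!natrD ler_nat -subnDA addnC -leq_subLR.
  by rewrite -natr1 in PN; lra.
have e4f : 4 <= 4 * f%:R / eps ^+ 2.
  rewrite ler_pdivlMr // ler_wpM2l //; apply: le_trans f1.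
  by rewrite exprn_ile1 ?(ltW e0) //; lra.
pose theta := eps / f%:R.
have th0 : 0 < theta by rewrite divr_gt0.
have the : theta <= eps by rewrite ler_pdivrMr // ler_peMr // ltW.
pose c := theta * (1 + 4 * eps).
have c0 : 0 <= c by rewrite mulr_ge0 ?(ltW th0) //; lra.
have lam1 : 1 <= expR theta by apply: le_trans (expR_ge1Dx _); rewrite lerDl ltW.
have p01 : 0 <= p <= 1 by rewrite ltW.
have step b : (m <= b <= n)%N ->
    (expR theta - 1) * (1 + edge_rate a.+1 m f q (expR theta) c b) <= c.
  move=> /andP[mb _]; apply: step_rate_bound => //; rewrite qm.
  rewrite -!mulrA ler_wpM2l // ler_wpM2l ?(ltW fR) // ler_peMl ?invr_ge0 ?(ltW e2) //.
  by rewrite exprn_ege1.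
have qE4 : 4 <= q * (m%:R / E) ^+ a by rewrite qE.
have fin := @packing_finite R a.+1 n m f N d L q p (expR theta) c E
  ((1 - 9 * eps) * P) isT m0 mn mf q0 q1 p01 Lq lam1 c0 (expR1_bound R) qE4 step aN.
apply: le_trans fin _.
have d0 : 0 < d.+1%:R :> R by rewrite ltr0n.
have rate0 : 0 <= edge_rate a.+1 m f q (expR theta) c n by apply: edge_rate_ge0.
have term1 : n%:R ^+ a.+1 * expR theta ^- L *
    (1 + edge_rate a.+1 m f q (expR theta) c n) ^+ N <= eps.
  set rate := edge_rate _ _ _ _ _ _ _ in rate0 *.
  have rN : N%:R * rate <= theta * X * (1 - eps).
    exact: (exponent_bound f0 m0 mn l1 e0 e1 E1 q0 (ltW p0) fl ml qm NP Ll).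
  apply: (@le_trans _ _ (expR (- l))).
    apply: (@le_trans _ _ (expR (a.+1%:R * l - L%:R * theta + N%:R * rate))).
      rewrite expRD expRB !expRM_natl -nl ler_wpM2l ?divr_ge0 ?exprn_ge0 ?expR_ge0 //.
      by rewrite lerXn2r ?nnegrE ?expR_ge0 ?expR_ge1Dx // addr_ge0.
    (* The budget 2 (a + 3) l covers (a + 1) l from n^(a + 1), theta from rounding [L], and the gain
       of l. *)
    rewrite ler_expR.
    have Lth : theta * X - theta <= L%:R * theta.
      rewrite -[X in _ - X]mulr1 -mulrBr mulrC ler_wpM2r ?(ltW th0) //.
      by rewrite -natr1 in XL; lra.
    have tX : theta * X * eps = eps ^+ 2 * X / f%:R.
      by rewrite /theta; field; rewrite gt_eqF.
    have tX' : theta * X * (1 - eps) = theta * X - theta * X * eps by ring.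
    have a1l : a.+1%:R * l = a.+3%:R * l - 2 * l by rewrite -[a.+3%:R]natr1 -[a.+2%:R]natr1; ring.
    rewrite tX' tX in rN; lra.
  rewrite expRN -nl; have : 1 <= eps * n%:R.
    by apply: le_trans le1 _; rewrite mulrC ler_wpM2l ?(ltW e0) // nl (le_trans _ (expR_ge1Dx _)) // lerDr.
  by rewrite -ler_pdivrMr // div1r.
have term2 : d.+1%:R^-1 * (N%:R * (f%:R * (4 / (q * (m%:R / E) ^+ a)))) <= eps.
  rewrite qE (_ : f%:R * _ = eps ^+ 2); last by field; rewrite !gt_eqF.
  rewrite mulrC ler_pdivrMr //; apply: (@le_trans _ _ (P * eps ^+ 2)).
    rewrite ler_wpM2r ?(ltW e2) //; apply: le_trans NP _; rewrite ler_piMl //; lra.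
  by rewrite expr2 mulrCA ler_wpM2l ?(ltW e0) // mulrC ltW.
(* Since L q <= p, the expected number of coincidences is at most n^(a + 1) p^2 = n p P <= eps^2 P,
   while d + 1 exceeds eps P. *)
have term3 : d.+1%:R^-1 * (q ^+ 2 * (n ^ a.+1 * 'C(L, 2))%:R) <= eps.
  rewrite mulrC ler_pdivrMr //; apply: (@le_trans _ _ (eps * (eps * P))); last first.
    by rewrite ler_wpM2l ?(ltW e0) // ltW.
  apply: (@le_trans _ _ (n%:R * p * P)).
    rewrite natrM natrX mulrCA /P (_ : n%:R * p * _ = n%:R ^+ a.+1 * p ^+ 2); last by rewrite exprS; ring.
    rewrite ler_wpM2l ?exprn_ge0 ?ler0n //.
    apply: (@le_trans _ _ ((L%:R * q) ^+ 2)); last first.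
      by apply: lerXn2r => //; rewrite nnegrE ?(ltW p0) // mulr_ge0 ?ler0n ?(ltW q0).
    rewrite exprMn mulrC ler_wpM2r ?exprn_ge0 ?(ltW q0) // -natrX ler_nat.
    by rewrite bin2 -divn2 (leq_trans (leq_div _ _)) // expnS expn1 leq_mul2l leq_pred orbT.
  rewrite mulrA ler_wpM2r // -expr2; move: pn; rewrite ler_pdivlMr //.
  by rewrite mulrC.
by rewrite (_ : 3 * eps = eps + eps + eps); [rewrite lerD // lerD | ring].
Qed.

(** * Conclusion *)

Lemma near_le_ln (R : realType) (C : R) : \forall n \near \oo, C <= ln (n%:R : R).
Proof.
near=> n.
have n0 : expR C <= n%:R :> R by near: n; apply: nbhs_infty_ger.
have nR : 0 < n%:R :> R by apply: lt_le_trans n0; apply: expR_gt0.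
by rewrite -ler_expR lnK.
Unshelve. all: by end_near. Qed.

(** The single term l^(j + 1) / (j + 1)! of the exponential series suffices. *)
Lemma expr_le_expR (R : realType) (C l : R) (j : nat) : 0 <= l ->
  C * j.+1`!%:R <= l -> C * l ^+ j <= expR l.
Proof.
move=> l0 Cl; apply: le_trans (expR_ge1Dxn j l0).
rewrite -[leLHS]add0r lerD // ler_pdivlMr ?ltr0n ?fact_gt0 //.
by rewrite mulrAC exprS ler_wpM2r // exprn_ge0.
Qed.

Lemma setprob_le_Pr (R : realType) (k n : nat) (p a b eta : R) : 0 <= p <= 1 -> b <= a ->
  setprob p (complete_kpartite k n) (fun H => (~~ packing_number_ge a H)%:R) <= eta ->
  1 - eta <= Pr_kpartite p (@packing_number_ge R k n b).
Proof.
move=> p01 ba le_eta; rewrite Pr_kpartiteE lerD2l lerN2; apply: le_trans le_eta.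
apply: ler_setprob => // H _; rewrite ler_nat.
case: (boolP (packing_number_ge a H)) => [/existsP[F /andP[FH aF]]|_]; last first.
  by case: packing_number_ge.
rewrite (_ : packing_number_ge b H) //; apply/existsP; exists F.
by rewrite FH (le_trans ba).
Qed.

(** The sparse case fails with probability at most 3 eps, which the colouring divides by delta;
    hence [eps] is taken as [delta ^+ 2]. *)
Lemma packing_whp (R : realType) (a : nat) (delta : R) : (1 < a)%N ->
  0 < delta -> 20 * delta <= 1 ->
  exists C : R, forall (n : nat) (p : R), C <= ln n%:R ->
    ln n%:R ^+ (4 * a.+1) / n%:R ^+ a <= p -> p <= 1 ->
    1 - 3 * delta <= Pr_kpartite p
      (@packing_number_ge R a.+1 n ((1 - 2 * delta) * n%:R ^+ a * p)).
Proof.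
move=> a1 d0 d1; pose eps := delta ^+ 2.
have e0 : 0 < eps by rewrite exprn_gt0.
have ed : eps <= delta / 20 by rewrite /eps expr2 ler_wpM2l ?(ltW d0) //; lra.
have e1 : 20 * eps <= 1 by lra.
pose j := (4 * a.+1)%N.
(* The summands ensure in turn l >= 1, the largeness required by [packing_sparse], 2 l^3 <= n, and
   (2 / eps^2) l^j <= n. *)
exists (1 + 72 * a.+3%:R * (2 * expR 1) ^+ a / eps ^+ 4 + 2 * 4`!%:R + 2 / eps ^+ 2 * j.+1`!%:R).
move=> n p; set l := ln n%:R => Cl lp p1.
have A0 : 0 <= 72 * a.+3%:R * (2 * expR 1) ^+ a / eps ^+ 4 :> R.
  have E0 : 0 <= 2 * expR 1 :> R by rewrite mulr_ge0 ?expR_ge0.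
  by apply: divr_ge0; [apply: mulr_ge0; [apply: mulr_ge0 | apply: exprn_ge0] | rewrite exprn_ge0 // ltW].
have B0 : 0 <= 2 * 4`!%:R :> R by rewrite mulr_ge0.
have D0 : 0 <= 2 / eps ^+ 2 * j.+1`!%:R :> R by rewrite mulr_ge0 // divr_ge0 // exprn_ge0 // ltW.
set A := 72 * _ * _ / _ in Cl A0.
set B := 2 * 4`!%:R in Cl B0; set D := 2 / _ * _ in Cl D0.
have l1 : 1 <= l by lra.
have lA : A <= l by lra.
have lB : B <= l by lra.
have lD : D <= l by lra.
have l0 : 0 <= l by lra.
have nR : 0 < n%:R :> R.
  by rewrite ltNge; apply/negP => /ln0; rewrite -/l => l00; lra.
have n0 : (0 < n)%N by rewrite -(ltr_nat R).
have n1 : 1 <= n%:R :> R by rewrite ler1n.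
have nl : n%:R = expR l by rewrite /l lnK.
have ln3 : 2 * l ^+ 3 <= n%:R by rewrite nl; apply: expr_le_expR.
have lnj : 2 / eps ^+ 2 * l ^+ j <= n%:R by rewrite nl; apply: expr_le_expR.
have e2 : 0 < eps ^+ 2 by rewrite exprn_gt0.
have p0 : 0 <= p.
  by apply: le_trans lp; rewrite divr_ge0 ?exprn_ge0 ?ler0n.
pose y := p * n%:R / eps ^+ 2.
have y0 : 0 <= y by apply: divr_ge0; [rewrite mulr_ge0 // ltW | exact: ltW].
have /andP[sy ys] := truncn_itv y0.
(* With more than p n / eps^2 colours, the density p / s of a class is at most eps^2 / n. *)
set s := (Num.truncn y).+1 in ys.
have sR : 0 < s%:R :> R by rewrite ltr0n.
pose p' := p / s%:R.
have sp : s%:R * p' = p by rewrite mulrC divfK // gt_eqF.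
have p'0 : 0 <= p' by rewrite divr_ge0 // ltW.
have p'p : p' <= p by rewrite ler_pdivrMr // ler_peMr // ler1n.
have p'n : p' <= eps ^+ 2 / n%:R.
  rewrite ler_pdivrMr // mulrAC ler_pdivlMr // [leRHS]mulrC.
  by rewrite -ler_pdivrMr // ltW.
(* If s = 1 this is the hypothesis on [p]. Otherwise s <= 2 y, so p / s is at least eps^2 / (2 n),
   which is large enough because a >= 2. *)
have lp' : l ^+ j / n%:R ^+ a <= p'.
  have [s1|s1] := posnP (Num.truncn y).
    by rewrite /p' /s s1 divr1.
  have s2 : s%:R <= 2 * y.
    have : 1 <= (Num.truncn y)%:R :> R by rewrite ler1n.
    by rewrite /s -natr1; lra.
  apply: (@le_trans _ _ (eps ^+ 2 / (2 * n%:R))).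
    rewrite ler_pdivrMr ?exprn_gt0 // mulrAC ler_pdivlMr ?mulr_gt0 //.
    have nn : n%:R ^+ 2 <= n%:R ^+ a :> R by rewrite ler_weXn2l.
    apply: le_trans (ler_wpM2l (ltW e2) nn).
    rewrite [n%:R ^+ 2]expr2 !mulrA ler_wpM2r ?(ltW nR) //.
    have : 2 * l ^+ j <= n%:R * eps ^+ 2.
      by rewrite -ler_pdivrMr // mulrAC.
    lra.
  rewrite /p' ler_pdivlMr // mulrAC ler_pdivrMr ?mulr_gt0 //.
  apply: le_trans (ler_wpM2l (ltW e2) s2) _.
  rewrite (_ : eps ^+ 2 * (2 * y) = p * (2 * n%:R)) //.
  by rewrite /y; field; rewrite gt_eqF.
have sparse := packing_sparse e0 e1 nl ln3 lA lp' p'n (le_trans p'p p1).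
have P0 : 0 <= p' * n%:R ^+ a by rewrite mulr_ge0 // exprn_ge0 // ltW.
have c0 : 0 <= (1 - 9 * eps) * (p' * n%:R ^+ a) by rewrite mulr_ge0 //; lra.
have sp1 : s%:R * p' <= 1 by rewrite sp.
have s0 : (0 < s)%N by [].
have a0 : (0 < a.+1)%N by [].
have dense := setprob_colours a0 n0 s0 p'0 sp1 c0 d0 sparse.
rewrite sp in dense.
rewrite (_ : 3 * delta = 3 * eps / delta); last by rewrite /eps; field; rewrite gt_eqF.
apply: setprob_le_Pr dense; first by rewrite p0.
have -> : (1 - delta) * (s%:R * ((1 - 9 * eps) * (p' * n%:R ^+ a))) =
    (1 - delta) * (1 - 9 * eps) * (n%:R ^+ a * p).
  by rewrite -sp; ring.
rewrite -mulrA ler_wpM2r ?mulr_ge0 ?exprn_ge0 ?(ltW nR) //.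
rewrite -subr_ge0 (_ : _ - _ = delta - 9 * eps + 9 * delta * eps); last by ring.
have : 0 <= delta * eps by rewrite mulr_ge0 ?(ltW d0) ?(ltW e0).
lra.
Qed.

(** Take for [J n] the largest j <= n with [G j n]. Each fixed j is eventually a candidate, so [J]
    tends to infinity; the candidate 0 excludes an empty maximum for large n. *)
Lemma diagonal_near (G : nat -> nat -> bool) :
  (forall j, \forall n \near \oo, G j n) ->
  exists J : nat -> nat,
    (forall j, \forall n \near \oo, (j <= J n)%N) /\ \forall n \near \oo, G (J n) n.
Proof.
move=> Gn; pose J n := (\max_(j < n.+1 | G j n) j)%N.
have GJ j n : (j <= n)%N -> G j n -> (j <= J n)%N && G (J n) n.
  move=> jn Gjn; have jP : G (inord j : 'I_n.+1) n by rewrite inordK.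
  apply/andP; split.
    apply: leq_trans (leq_bigmax_cond (F := @nat_of_ord n.+1) _ jP).
    by rewrite inordK.
  rewrite /J (bigop.bigmax_eq_arg (inord j : 'I_n.+1)) //.
  by case: arg_maxnP.
exists J; split=> [j|].
  near=> n; have jn : (j <= n)%N by near: n; apply: nbhs_infty_ge.
  have Gjn : G j n by near: n; apply: Gn.
  by have /andP[] := GJ j n jn Gjn.
near=> n; have G0n : G 0%N n by near: n; apply: Gn.
by have /andP[] := GJ 0%N n isT G0n.
Unshelve. all: by end_near. Qed.

Theorem theorem2 (R : realType) (k : nat) (hk : (3 <= k)%N) (p : nat -> R)
  (p01 : forall n : nat, 0 <= p n <= 1)
  (hp : \forall n \near \oo, ln (n%:R : R) ^+ (4 * k) / n%:R ^+ (k - 1) <= p n) :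
  exists eps : nat -> R,
    eps n @[n --> \oo] --> (0 : R) /\
    Pr_kpartite (p n) (fun H : {set {set vertex k n}} =>
      [exists F : {set {set {set vertex k n}}},
        disjoint_perfect_matchings H F &&
        ((1 - eps n) * n%:R ^+ (k - 1) * p n <= #|F|%:R)])
      @[n --> \oo] --> (1 : R).
Proof.
case: k hk p01 hp => // a; rewrite ltnS => a1 p01; rewrite subn1 /= => hp.
pose delta j : R := (20 * j.+1%:R)^-1.
have d0 j : 0 < delta j by rewrite invr_gt0 mulr_gt0 ?ltr0n.
have d1 j : 20 * delta j <= 1.
  by rewrite /delta invfM mulrA mulfV // mul1r invf_le1 ?ler1n ?ltr0n.
have dmono i j : (i <= j)%N -> delta j <= delta i.
  by move=> ij; rewrite lef_pV2 ?posrE ?mulr_gt0 ?ltr0n // ler_wpM2l // ler_nat ltnS.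
pose G j n := 1 - 3 * delta j <= Pr_kpartite (p n)
  (@packing_number_ge R a.+1 n ((1 - 2 * delta j) * n%:R ^+ a * p n)).
have Gn j : \forall n \near \oo, G j n.
  have [C whp] := packing_whp a1 (d0 j) (d1 j).
  near=> n; apply: whp; [by near: n; apply: near_le_ln | by near: n | ].
  by have /andP[] := p01 n.
have [J [Jinf GJ]] := diagonal_near Gn.
have dsmall (e : R) : 0 < e -> exists j, 3 * delta j <= e.
  move=> e_gt0; exists (Num.truncn e^-1).
  have := truncnS_gt e^-1; set s := (Num.truncn _).+1%:R => es.
  have s0 : 0 < s :> R by rewrite ltr0n.
  rewrite /delta -/s ler_pdivrMr ?mulr_gt0 //.
  have : 1 <= e * s by rewrite -ler_pdivrMl // mulr1 ltW.
  lra.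
(* Along the diagonal, both the loss 2 delta and the failure probability 3 delta tend to 0. *)
exists (fun n => 2 * delta (J n)); split.
  apply/cvgrPdist_le => e e_gt0; have [j je] := dsmall e e_gt0.
  near=> n; have jJ : (j <= J n)%N by near: n.
  rewrite sub0r normrN ger0_norm ?mulr_ge0 ?(ltW (d0 _)) //.
  by have := dmono _ _ jJ; have := d0 j; lra.
apply/cvgrPdist_le => e e_gt0; have [j je] := dsmall e e_gt0.
near=> n; have jJ : (j <= J n)%N by near: n.
have GJn : G (J n) n by near: n.
have := GJn; rewrite /G; set Q := Pr_kpartite _ _ => Qge.
have Q1 : Q <= 1.
  rewrite /Q Pr_kpartiteE gerBl; apply: setprob_ge0; first exact: p01.
  by move=> H; rewrite ler0n.
change (`|1 - Q| <= e).
rewrite ger0_norm ?subr_ge0 //; have := dmono _ _ jJ; lra.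
Unshelve. all: by end_near. Qed.
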